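(* Let $\kappa_{\rm i},e_0\in\mathbb{R}$ with $(\kappa_{\rm i},e_0)\neq(0,0)$, put $e_1=\kappa_{\rm i}^2/48$, and let $\wp,\zeta$ be the Weierstrass functions with invariants $$G_2=12(13e_1^2+16e_0^2),\qquad G_3=8(35e_1^2+48e_0^2)e_1 .$$ For $k=0,1$ let $\xi_k\in\mathbb{C}$ be a point such that $$\wp(\xi_k)=-2e_1+(-1)^k i\sqrt3\,(3e_1+4ie_0),\qquad \wp'(\xi_k)=\tfrac12\bigl(3-(-1)^k i\sqrt3\bigr)\kappa_{\rm i}(3e_1+4ie_0).$$ Then the function $$B(\xi)=\frac{\kappa_{\rm i}}2+\zeta(\xi)+\frac{-1+i\sqrt3}{2}\bigl(\zeta(\xi-\xi_0)+\zeta(\xi_0)\bigr)+\frac{-1-i\sqrt3}{2}\bigl(\zeta(\xi-\xi_1)+\zeta(\xi_1)\bigr)$$ is equal to $$\frac{\kappa_{\rm i}}2-\frac{6\kappa_{\rm i}(3e_1+4ie_0)^2+\bigl(\wp(\xi)+2e_1+3(3e_1+4ie_0)\bigr)\wp'(\xi)}{2\bigl((\wp(\xi)+2e_1)^2+3(3e_1+4ie_0)^2\bigr)},$$ and $B$, as well as each of its translates $\xi\mapsto B(\xi-a)$ with $a\in\mathbb{C}$, is a solution of the first order differential equation $$(2B'+\kappa_{\rm i}B+24ie_0)(B'-\kappa_{\rm i}B-24ie_0)^2+2^{-11}\Bigl(16(4B^3-3\kappa_{\rm i}B^2)-9(\kappa_{\rm i}^2+64ie_0)(4B+\kappa_{\rm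 i})\Bigr)^2=0 .$$
   Context: Here $i^2=-1$ and $'=d/d\xi$. The Weierstrass functions with invariants $G_2,G_3$ are $\wp$, with $\wp'^2=4\wp^3-G_2\wp-G_3$ and a double pole at the origin, and $\zeta$, the odd meromorphic function with $\zeta'=-\wp$. For the values above, $\wp'^2=4(\wp+2e_1)(\wp^2-2e_1\wp-35e_1^2-48e_0^2)$. The differential equation in the claim is the one satisfied by the logarithmic derivative $B=\frac{d}{d\xi}\log\bigl(A\,e^{i\omega t-ics_r\xi/2}\bigr)$ of the complex amplitude $A$ for the elliptic traveling wave solution of the quintic complex Ginzburg-Landau equation. *)

(* Defs.v *)
From Stdlib Require Import Reals.
From Coquelicot Require Import Coquelicot.
Open Scope C_scope.

Definition Cderivable (f : C -> C) (z : C) : Prop :=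
  @ex_derive C_AbsRing C_NormedModule f z.

(* [p] is a pole of order [m] of [f]: near [p], [f z = g z / (z - p) ^ m] with
   [g] holomorphic and [g p <> 0]. *)
Definition pole (f : C -> C) (p : C) (m : nat) : Prop :=
  (1 <= m)%nat /\
  exists g : C -> C,
    locally (T := C_UniformSpace) p (Cderivable g) /\ g p <> 0 /\
    locally' (T := C_UniformSpace) p (fun z => (z - p) ^ m * f z = g z).

(* A meromorphic function on the plane is a total function whose points of
   non-differentiability are isolated and are all poles.  Its values at the
   poles are meaningless, so the points where it is defined, as a meromorphic
   function, are those satisfying [Cderivable f]. *)
Definition meromorphic (f : C -> C) : Prop :=
  forall p : C,
    locally' (T := C_UniformSpace) p (Cderivable f) /\
    (Cderivable f p \/ exists m : nat, pole f p m).

(* Equality of the functions denoted by two expressions, which may take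
   meaningless values at isolated points (poles, zeros of a denominator): they
   agree outside isolated points, and at every point where both are regular. *)
Definition mero_eq (f g : C -> C) : Prop :=
  (forall p : C, locally' (T := C_UniformSpace) p (fun z => f z = g z)) /\
  (forall z : C, Cderivable f z -> Cderivable g z -> f z = g z).

(* The differential equation and the pole at the origin determine [wp] off its
   poles; oddness fixes the additive constant of [zeta]. *)
Definition weierstrass (G2 G3 : C) (wp zeta : C -> C) : Prop :=
  meromorphic wp /\ pole wp 0 2 /\
  (forall z, Cderivable wp z ->
     C_derive wp z ^ 2 = 4 * wp z ^ 3 - G2 * wp z - G3) /\
  meromorphic zeta /\
  (forall z, Cderivable zeta z -> zeta (- z) = - zeta z) /\
  (forall z, Cderivable zeta z -> C_derive zeta z = - wp z).

(* [F] is a meromorphic solution of the equation [E (F, F') = 0]. *)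
Definition mero_solution (E : C -> C -> C) (F : C -> C) : Prop :=
  meromorphic F /\
  forall z, Cderivable F z -> E (F z) (C_derive F z) = 0.

(* Main.v *)
Require Import Defs.
From Stdlib Require Import Reals.
From Coquelicot Require Import Coquelicot.
From Stdlib Require Import Lra Psatz Classical.
Open Scope C_scope.

(** Put f for wp, o0 and o1 for the two primitive cube roots of unity, and
    F_k x = zeta (x - xi_k) + zeta xi_k - zeta x. Since 1 + o0 + o1 = 0,
    B = kappa / 2 + o0 F_0 + o1 F_1. The addition theorem ([addition]) reads
      2 F_k (f - f xi_k) = f' + f' xi_k  and  f (x - xi_k) = F_k^2 - f - f xi_k.
    The first equation makes B rational in f and f', which is the announced formula;
    the second does the same for B' = - f - o0 f (x - xi_0) - o1 f (x - xi_1). The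
    differential equation then becomes an identity modulo the cubic relation between
    f and f' ([amplitude_curve]), valid outside the isolated points where f takes one
    of the values f xi_k, and everywhere by continuity ([B_relation]).

    The addition theorem is derived from the equation f'^2 = cubic f and the pole at 0
    by real-variable methods along segments: mean value inequalities, uniqueness for
    linear differential systems, and connectedness of the plane. The argument is the
    same for all invariants, including the degenerate ones.
    - Regularity. Squaring loses the sign of f', and the constant roots of the cubic
      also solve the equation, so f'' = 6 f^2 - G2 / 2 has to be earned. The derivative
      f' is continuous ([f'_cont]); its zeros are isolated, because f would otherwise be
      constant on an open set, and then everywhere, against its pole at 0
      ([f'_zeros_isolated]); hence the second order equation holds at all regular
      points ([f'']).
    - Zeta. Near a pole of f the function zeta + f' / (2 f) has a derivative that tends
      to 0. It follows that f and zeta have the same regular points and, by oddness,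
      that this function tends to 0 at 0 ([Psi_0]).
    - Addition. The defects E, M, T of the three equations that express collinearity
      of three points of the cubic solve a homogeneous linear differential system. They
      vanish around 0, where everything is explicit, hence on every path that avoids
      the poles ([EMT_near]).

    The addition theorem also locates the poles: it keeps f (x - xi_k) finite at the
    poles of f, and f (x - xi_k) can only be infinite where f takes the value f xi_k.
    As f xi_0 and f xi_1 differ, the three terms of B never have a pole in common, so
    B is meromorphic and each of its regular points is regular for all three
    terms ([B_pole]). *)

(** * Neighbourhoods *)

(** The neighbourhood filter of the plane in terms of the modulus, which is what all
    estimates use; near' is its punctured version. *)
Definition near (p : C) (P : C -> Prop) : Prop :=
  exists d : R, (0 < d)%R /\ forall z, (Cmod (z - p) < d)%R -> P z.

Definition near' (p : C) (P : C -> Prop) : Prop :=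
  near p (fun z => z <> p -> P z).

Lemma locally_near (p : C) (P : C -> Prop) :
  locally (T := C_UniformSpace) p P <-> near p P.
Proof.
  split.
  - intros H.
    destruct (@locally_norm_le_locally C_AbsRing C_NormedModule p P H)
      as [d Hd].
    exists d; split; [apply cond_pos|]. intros z Hz. apply Hd. exact Hz.
  - intros [d [d0 Hd]].
    apply (@locally_le_locally_norm C_AbsRing C_NormedModule p P).
    exists (mkposreal d d0). intros z Hz. apply Hd. exact Hz.
Qed.

Lemma locally'_near' (p : C) (P : C -> Prop) :
  locally' (T := C_UniformSpace) p P <-> near' p P.
Proof. exact (locally_near p (fun z => z <> p -> P z)). Qed.

Lemma near_at p P : near p P -> P p.
Proof.
  intros [d [d0 H]]. apply H. replace (p - p) with (RtoC 0) by ring.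
  now rewrite Cmod_0.
Qed.

Lemma near_and p P Q : near p P -> near p Q -> near p (fun z => P z /\ Q z).
Proof.
  intros [d [d0 H]] [d' [d0' H']]. exists (Rmin d d'). split.
  - now apply Rmin_glb_lt.
  - intros z Hz. split.
    + apply H. eapply Rlt_le_trans; [exact Hz | apply Rmin_l].
    + apply H'. eapply Rlt_le_trans; [exact Hz | apply Rmin_r].
Qed.

Lemma near_imp p (P Q : C -> Prop) :
  (forall z, P z -> Q z) -> near p P -> near p Q.
Proof. intros HPQ [d [d0 H]]. exists d; split; auto. Qed.

Lemma near_all p (P : C -> Prop) : (forall z, P z) -> near p P.
Proof. intros H. exists 1%R. split; [lra | auto]. Qed.

Lemma near'_and p P Q : near' p P -> near' p Q -> near' p (fun z => P z /\ Q z).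
Proof.
  intros H1 H2. refine (near_imp _ _ _ _ (near_and _ _ _ H1 H2)).
  intros z [A B] C0. auto.
Qed.

Lemma near'_imp p (P Q : C -> Prop) :
  (forall z, P z -> Q z) -> near' p P -> near' p Q.
Proof. intros H. apply near_imp. auto. Qed.

Lemma near_near' p P : near p P -> near' p P.
Proof. apply near_imp. auto. Qed.

Lemma near'_near p (P : C -> Prop) : P p -> near' p P -> near p P.
Proof.
  intros Hp. apply near_imp. intros z H.
  destruct (classic (z = p)) as [->|]; auto.
Qed.

Lemma near_near p P : near p P -> near p (fun z => near z P).
Proof.
  intros [d [d0 H]]. exists (d / 2)%R. split; [lra|].
  intros z Hz. exists (d / 2)%R. split; [lra|]. intros y Hy. apply H.
  replace (y - p) with ((y - z) + (z - p)) by ring.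
  eapply Rle_lt_trans; [apply Cmod_triangle | lra].
Qed.

Lemma near_neq (p q : C) : p <> q -> near p (fun z => z <> q).
Proof.
  intros H. assert (H0 : p - q <> 0) by now apply Cminus_eq_contra.
  exists (Cmod (p - q)). split; [now apply Cmod_gt_0|].
  intros z Hz ->. apply (Rlt_irrefl (Cmod (p - q))).
  replace (p - q) with (- (q - p)) at 1 by ring. now rewrite Cmod_opp.
Qed.

Lemma near'_near_near p P : near' p P -> near' p (fun z => near z P).
Proof.
  intros H. refine (near_imp _ _ _ _ (near_near _ _ H)).
  intros z Hz Hne.
  refine (near_imp _ _ _ _ (near_and _ _ _ Hz (near_neq z p Hne))).
  intros y [A B]. auto.
Qed.

Lemma near'_exists p P :
  near' p P -> forall d, (0 < d)%R ->
  exists z, z <> p /\ (Cmod (z - p) < d)%R /\ P z.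
Proof.
  intros [d' [d0' H]] d d0. set (r := (Rmin d d' / 2)%R).
  assert (Hr : (0 < r)%R).
  { apply Rdiv_lt_0_compat; [now apply Rmin_glb_lt | lra]. }
  assert (Hm : Cmod (p + r - p) = r).
  { replace (p + r - p) with (RtoC r) by ring.
    rewrite Cmod_R. apply Rabs_pos_eq. lra. }
  assert (r < d /\ r < d')%R.
  { unfold r in *. pose proof (Rmin_l d d'). pose proof (Rmin_r d d'). lra. }
  assert (p + r <> p).
  { intros E. rewrite E in Hm. replace (p - p) with (RtoC 0) in Hm by ring.
    rewrite Cmod_0 in Hm. lra. }
  exists (p + r). rewrite Hm. repeat split; try easy. apply H; [|easy].
  rewrite Hm. easy.
Qed.

Lemma near_translate p s P :
  near (p - s) P <-> near p (fun z => P (z - s)).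
Proof.
  split; intros [d [d0 H]]; exists d; split; auto; intros z Hz.
  - apply H. now replace (z - s - (p - s)) with (z - p) by ring.
  - replace z with (z + s - s) by ring. apply H.
    now replace (z + s - p) with (z - (p - s)) by ring.
Qed.

Lemma near'_translate p s P :
  near' (p - s) P <-> near' p (fun z => P (z - s)).
Proof.
  unfold near'. rewrite near_translate. split; apply near_imp; intros z H N;
  apply H; intros E; apply N.
  - replace z with (z - s + s) by ring. rewrite E. ring.
  - now rewrite E.
Qed.

(** * Limits *)

Definition clim (f : C -> C) (p l : C) : Prop :=
  forall eps : R, (0 < eps)%R -> near' p (fun z => (Cmod (f z - l) < eps)%R).

Lemma clim_ext f g p l :
  near' p (fun z => f z = g z) -> clim f p l -> clim g p l.
Proof.
  intros H Hf eps e0.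
  refine (near'_imp _ _ _ _ (near'_and _ _ _ H (Hf eps e0))).
  intros z [-> Hz]. exact Hz.
Qed.

Lemma clim_const c p : clim (fun _ => c) p c.
Proof.
  intros eps e0. apply near_all. intros z _.
  replace (c - c) with (RtoC 0) by ring. now rewrite Cmod_0.
Qed.

Lemma clim_id p : clim (fun z => z) p p.
Proof. intros eps e0. exists eps. split; auto. Qed.

Lemma clim_plus f g p (l m : C) :
  clim f p l -> clim g p m -> clim (fun z => f z + g z) p (l + m).
Proof.
  intros Hf Hg eps e0.
  assert (e2 : (0 < eps / 2)%R) by lra.
  refine (near'_imp _ _ _ _ (near'_and _ _ _ (Hf _ e2) (Hg _ e2))).
  intros z [A B].
  replace (f z + g z - (l + m)) with ((f z - l) + (g z - m)) by ring.
  eapply Rle_lt_trans; [apply Cmod_triangle | lra].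
Qed.

Lemma clim_bounded f p l :
  clim f p l -> near' p (fun z => (Cmod (f z) < Cmod l + 1)%R).
Proof.
  intros H. refine (near'_imp _ _ _ _ (H 1%R Rlt_0_1)).
  intros z Hz. replace (f z) with ((f z - l) + l) by ring.
  eapply Rle_lt_trans; [apply Cmod_triangle | lra].
Qed.

(* A bounded function times one that tends to 0. *)
Lemma clim_bounded_0 f g p K :
  near' p (fun z => (Cmod (f z) <= K)%R) -> clim g p 0 ->
  clim (fun z => f z * g z) p 0.
Proof.
  intros Hf Hg eps e0.
  assert (HK : (0 < Rmax K 0 + 1)%R) by (pose proof (Rmax_r K 0); lra).
  assert (e1 : (0 < eps / (Rmax K 0 + 1))%R) by now apply Rdiv_lt_0_compat.
  refine (near'_imp _ _ _ _ (near'_and _ _ _ Hf (Hg _ e1))).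
  intros z [A B]. replace (f z * g z - 0) with (f z * (g z - 0)) by ring.
  rewrite Cmod_mult. pose proof (Rmax_l K 0).
  pose proof (Cmod_ge_0 (f z)). pose proof (Cmod_ge_0 (g z - 0)).
  apply Rle_lt_trans with ((Rmax K 0 + 1) * Cmod (g z - 0))%R.
  - apply Rmult_le_compat_r; lra.
  - apply Rlt_le_trans with ((Rmax K 0 + 1) * (eps / (Rmax K 0 + 1)))%R.
    + apply Rmult_lt_compat_l; lra.
    + right. field. lra.
Qed.

Lemma clim_eq f p l l' : l = l' -> clim f p l -> clim f p l'.
Proof. now intros ->. Qed.

Lemma clim_minus_0 f p l : clim f p l <-> clim (fun z => f z - l) p 0.
Proof.
  split; intros H.
  - apply (clim_eq _ _ (l + - l)); [ring|].
    apply (clim_plus f (fun _ => - l)); [exact H | apply clim_const].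
  - apply (clim_ext (fun z => (f z - l) + l)).
    + apply near_all. intros; ring.
    + apply (clim_eq _ _ (0 + l)); [ring|].
      apply (clim_plus (fun z => f z - l) (fun _ => l));
        [exact H | apply clim_const].
Qed.

Lemma clim_mult f g p l m :
  clim f p l -> clim g p m -> clim (fun z => f z * g z) p (l * m).
Proof.
  intros Hf Hg. apply clim_minus_0.
  apply (clim_ext (fun z => f z * (g z - m) + m * (f z - l))).
  { apply near_all. intros; ring. }
  apply (clim_eq _ _ (0 + 0)); [ring|].
  apply (clim_plus (fun z => f z * (g z - m)) (fun z => m * (f z - l))).
  - apply (clim_bounded_0 f (fun z => g z - m) _ (Cmod l + 1)).
    + refine (near'_imp _ _ _ _ (clim_bounded _ _ _ Hf)). intros; lra.
    + now apply (clim_minus_0 g).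
  - apply (clim_bounded_0 (fun _ => m) (fun z => f z - l) _ (Cmod m)).
    + apply near_all. intros; lra.
    + now apply (clim_minus_0 f).
Qed.

Lemma clim_opp f p l : clim f p l -> clim (fun z => - f z) p (- l).
Proof.
  intros H. apply (clim_ext (fun z => (-1) * f z)).
  { apply near_all. intros; ring. }
  apply (clim_eq _ _ (-1 * l)); [ring|].
  apply (clim_mult (fun _ => RtoC (-1))); [apply clim_const | exact H].
Qed.

Lemma clim_minus f g p l m :
  clim f p l -> clim g p m -> clim (fun z => f z - g z) p (l - m).
Proof. intros Hf Hg. apply clim_plus; [exact Hf | now apply clim_opp]. Qed.

Lemma clim_far f p l k :
  clim f p l -> l <> k ->
  near' p (fun z => (Cmod (l - k) / 2 <= Cmod (f z - k))%R).
Proof.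
  intros H Hne. assert (H0 : l - k <> 0) by now apply Cminus_eq_contra.
  apply Cmod_gt_0 in H0. assert (e0 : (0 < Cmod (l - k) / 2)%R) by lra.
  refine (near'_imp _ _ _ _ (H _ e0)). intros z Hz.
  assert (Cmod (l - k) <= Cmod (f z - l) + Cmod (f z - k))%R; [|lra].
  replace (l - k) with (- (f z - l) + (f z - k)) by ring.
  eapply Rle_trans; [apply Cmod_triangle | rewrite Cmod_opp; lra].
Qed.

Lemma clim_neq f p l k : clim f p l -> l <> k -> near' p (fun z => f z <> k).
Proof.
  intros H Hne. refine (near'_imp _ _ _ _ (clim_far _ _ _ _ H Hne)).
  intros z Hz Hk. rewrite Hk in Hz. assert (H0 : l - k <> 0) by now apply Cminus_eq_contra.
  apply Cmod_gt_0 in H0. replace (k - k) with (RtoC 0) in Hz by ring.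
  rewrite Cmod_0 in Hz. lra.
Qed.

Lemma clim_inv f p (l : C) : l <> 0 -> clim f p l -> clim (fun z => / f z) p (/ l).
Proof.
  intros Hl H. apply clim_minus_0.
  pose proof (clim_far _ _ _ _ H Hl) as Hfar.
  pose proof (clim_neq _ _ _ _ H Hl) as Hneq.
  assert (Hl0 : (0 < Cmod l)%R) by now apply Cmod_gt_0.
  apply (clim_ext (fun z => - (/ f z * / l) * (f z - l))).
  { refine (near'_imp _ _ _ _ Hneq). intros z Hz. field. auto. }
  apply (clim_bounded_0 _ _ _ (2 / Cmod l * / Cmod l)).
  - refine (near'_imp _ _ _ _ (near'_and _ _ _ Hfar Hneq)). intros z [A B].
    rewrite Cmod_opp, Cmod_mult, !Cmod_inv by assumption.
    apply Rmult_le_compat_r; [left; now apply Rinv_0_lt_compat|].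
    replace (l - 0) with l in A by ring. replace (f z - 0) with (f z) in A by ring.
    replace (2 / Cmod l)%R with (/ (Cmod l / 2))%R by (field; lra).
    apply Rinv_le_contravar; lra.
  - apply (clim_minus_0 f). exact H.
Qed.

Lemma clim_div f g p (l m : C) :
  m <> 0 -> clim f p l -> clim g p m -> clim (fun z => f z / g z) p (l / m).
Proof. intros Hm Hf Hg. apply clim_mult; [exact Hf | now apply clim_inv]. Qed.

Lemma clim_unique f p l l' : clim f p l -> clim f p l' -> l = l'.
Proof.
  intros H H'. apply NNPP. intros Hne.
  assert (H0 : l - l' <> 0) by now apply Cminus_eq_contra.
  apply Cmod_gt_0 in H0. assert (e0 : (0 < Cmod (l - l') / 2)%R) by lra.
  destruct (near'_exists _ _ (near'_and _ _ _ (H _ e0) (H' _ e0)) 1 Rlt_0_1)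
    as [z [_ [_ [A B]]]].
  assert (Cmod (l - l') <= Cmod (f z - l) + Cmod (f z - l'))%R; [|lra].
  replace (l - l') with (- (f z - l) + (f z - l')) by ring.
  eapply Rle_trans; [apply Cmod_triangle | rewrite Cmod_opp; lra].
Qed.

Lemma clim_translate f p s l :
  clim f (p - s) l -> clim (fun z => f (z - s)) p l.
Proof. intros H eps e0. exact (proj1 (near'_translate p s _) (H eps e0)). Qed.

Lemma clim_sqr_0 g p : clim (fun y => g y ^ 2) p 0 -> clim g p 0.
Proof.
  intros H eps e0.
  assert (e2 : (0 < eps ^ 2)%R) by (apply pow_lt; exact e0).
  refine (near'_imp _ _ _ _ (H _ e2)). intros y Hy.
  replace (g y ^ 2 - 0) with (g y ^ 2) in Hy by ring.
  rewrite Cmod_pow in Hy. replace (g y - 0) with (g y) by ring.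
  apply Rnot_le_lt. intros N. pose proof (Cmod_ge_0 (g y)). nra.
Qed.

Lemma clim_pow f p (l : C) n : clim f p l -> clim (fun z => f z ^ n) p (l ^ n).
Proof.
  intros H. induction n as [|n IH]; simpl; [apply clim_const|].
  now apply clim_mult.
Qed.

(** * Complex derivatives *)

(** Derivatives are punctured limits of difference quotients, so that the rules of
    differentiation and the computation of second derivatives reduce to rules for
    limits. *)
Definition cderive (f : C -> C) (z d : C) : Prop :=
  clim (fun y => (f y - f z) / (y - z)) z d.

Lemma cderive_bound f z d :
  cderive f z d <->
  forall eps, (0 < eps)%R -> near z (fun y =>
    (Cmod (f y - f z - d * (y - z)) <= eps * Cmod (y - z))%R).
Proof.
  split; intros H eps e0.
  - refine (near'_near _ _ _ _).
    { replace (f z - f z - d * (z - z)) with (RtoC 0) by ring.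
      replace (z - z) with (RtoC 0) by ring. rewrite Cmod_0. lra. }
    apply near_imp with (2 := H eps e0). intros y Hy Hne. specialize (Hy Hne).
    apply Cminus_eq_contra in Hne.
    replace (f y - f z - d * (y - z))
      with (((f y - f z) / (y - z) - d) * (y - z)) by (field; exact Hne).
    rewrite Cmod_mult. apply Rmult_le_compat_r; [apply Cmod_ge_0 | lra].
  - assert (e2 : (0 < eps / 2)%R) by lra.
    apply near_imp with (2 := H _ e2). intros y Hy Hne.
    apply Cminus_eq_contra in Hne.
    assert (H0 : (0 < Cmod (y - z))%R) by now apply Cmod_gt_0.
    replace ((f y - f z) / (y - z) - d)
      with ((f y - f z - d * (y - z)) / (y - z)) by (field; exact Hne).
    rewrite Cmod_div by exact Hne. apply Rle_lt_trans with (eps / 2)%R; [|lra].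
    apply Rmult_le_reg_r with (1 := H0). unfold Rdiv at 1.
    rewrite Rmult_assoc, Rinv_l; lra.
Qed.

Lemma cderive_is_derive f z d :
  cderive f z d <-> @is_derive C_AbsRing C_NormedModule f z d.
Proof.
  rewrite cderive_bound. split.
  - intros H. split.
    + apply (@is_linear_scal_l C_AbsRing C_NormedModule d).
    + intros x Hx.
      assert (Ex : z = x)
        by exact (@is_filter_lim_locally_unique C_AbsRing
                   (AbsRing_NormedModule C_AbsRing) z x Hx).
      subst x.
      intros eps. apply locally_C, locally_near.
      apply near_imp with (2 := H eps (cond_pos eps)).
      intros y Hy.
      change (Cmod (f y - f z - (y - z) * d) <= eps * Cmod (y - z))%R.
      now replace ((y - z) * d) with (d * (y - z)) by ring.
  - intros [_ H] eps e0.
    specialize (H z (fun P HP => HP) (mkposreal eps e0)).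
    apply locally_C, locally_near in H. apply near_imp with (2 := H). intros y Hy.
    change (Cmod (f y - f z - (y - z) * d) <= eps * Cmod (y - z))%R in Hy.
    now replace (d * (y - z)) with ((y - z) * d) by ring.
Qed.

Lemma cderive_C_derive f z d : cderive f z d -> C_derive f z = d.
Proof. intros H. apply is_C_derive_unique. now apply cderive_is_derive. Qed.

Lemma cderive_derivable f z d : cderive f z d -> Cderivable f z.
Proof. intros H. exists d. now apply cderive_is_derive. Qed.

Lemma derivable_cderive f z : Cderivable f z -> cderive f z (C_derive f z).
Proof.
  intros [d H]. apply cderive_is_derive in H.
  now rewrite (cderive_C_derive _ _ _ H).
Qed.

Lemma cderive_eq f z d d' : d = d' -> cderive f z d -> cderive f z d'.
Proof. now intros ->. Qed.

Lemma cderive_ext f g z d : near z (fun y => f y = g y) -> cderive f z d -> cderive g z d.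
Proof.
  intros H. apply clim_ext. apply near_imp with (2 := H).
  intros y -> _. now rewrite (near_at _ _ H).
Qed.

Lemma cderive_cont f z d : cderive f z d -> clim f z (f z).
Proof.
  intros H. apply clim_minus_0.
  apply (clim_ext (fun y => (f y - f z) / (y - z) * (y - z))).
  - apply near_all. intros y Hy. field. now apply Cminus_eq_contra.
  - apply (clim_eq _ _ (d * 0)); [ring|].
    apply (clim_mult (fun y => (f y - f z) / (y - z))); [exact H|].
    apply (clim_minus_0 (fun y => y)). apply clim_id.
Qed.

Lemma cderive_const c z : cderive (fun _ => c) z 0.
Proof.
  apply (clim_ext (fun _ => 0)); [|apply clim_const].
  apply near_all. intros y Hy. field. now apply Cminus_eq_contra.
Qed.

Lemma cderive_id z : cderive (fun y => y) z 1.
Proof.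
  apply (clim_ext (fun _ => 1)); [|apply clim_const].
  apply near_all. intros y Hy. field. now apply Cminus_eq_contra.
Qed.

Lemma cderive_plus f g z d e :
  cderive f z d -> cderive g z e -> cderive (fun y => f y + g y) z (d + e).
Proof.
  intros Hf Hg. refine (clim_ext _ _ _ _ _ (clim_plus _ _ _ _ _ Hf Hg)).
  apply near_all. intros y Hy. field. now apply Cminus_eq_contra.
Qed.

Lemma cderive_mult f g z d e :
  cderive f z d -> cderive g z e ->
  cderive (fun y => f y * g y) z (d * g z + f z * e).
Proof.
  intros Hf Hg.
  pose proof (clim_mult _ _ _ _ _ Hf (clim_const (g z) z)) as H1.
  pose proof (clim_mult _ _ _ _ _ (cderive_cont _ _ _ Hf) Hg) as H2.
  refine (clim_ext _ _ _ _ _ (clim_plus _ _ _ _ _ H1 H2)).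
  apply near_all. intros y Hy. simpl. field. now apply Cminus_eq_contra.
Qed.

Lemma cderive_opp f z d : cderive f z d -> cderive (fun y => - f y) z (- d).
Proof.
  intros H. refine (clim_ext _ _ _ _ _ (clim_opp _ _ _ H)).
  apply near_all. intros y Hy. simpl. field. now apply Cminus_eq_contra.
Qed.

Lemma cderive_minus f g z d e :
  cderive f z d -> cderive g z e -> cderive (fun y => f y - g y) z (d - e).
Proof. intros Hf Hg. apply cderive_plus; [exact Hf | now apply cderive_opp]. Qed.

Lemma cderive_inv (f : C -> C) z d :
  f z <> 0 -> cderive f z d -> cderive (fun y => / f y) z (- d / (f z * f z)).
Proof.
  intros Hz Hf.
  pose proof (cderive_cont _ _ _ Hf) as Hc.
  pose proof (clim_inv _ _ _ Hz Hc) as Hi.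
  pose proof (clim_mult _ _ _ _ _ Hi (clim_const (- / f z) z)) as H'.
  pose proof (clim_mult _ _ _ _ _ Hf H') as H.
  refine (clim_eq _ _ _ _ _ (clim_ext _ _ _ _ _ H)).
  - simpl. field. exact Hz.
  - apply near_imp with (2 := clim_neq _ _ _ _ Hc Hz).
    intros y Hy Hne. specialize (Hy Hne). apply Cminus_eq_contra in Hne.
    simpl. field. auto.
Qed.

Lemma cderive_div (f g : C -> C) z d e :
  g z <> 0 -> cderive f z d -> cderive g z e ->
  cderive (fun y => f y / g y) z ((d * g z - f z * e) / (g z * g z)).
Proof.
  intros Hz Hf Hg.
  refine (cderive_eq _ _ _ _ _ (cderive_mult _ _ _ _ _ Hf (cderive_inv _ _ _ Hz Hg))).
  simpl. field. exact Hz.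
Qed.

Lemma cderive_translate f z s d :
  cderive f (z - s) d -> cderive (fun y => f (y - s)) z d.
Proof.
  intros H. refine (clim_ext _ _ _ _ _ (clim_translate _ _ _ _ H)).
  apply near_all. intros y Hy. simpl.
  now replace (y - s - (z - s)) with (y - z) by ring.
Qed.

Lemma cderive_reflect f z d : cderive f (- z) d -> cderive (fun y => f (- y)) z (- d).
Proof.
  rewrite !cderive_bound. intros H eps e0. destruct (H eps e0) as [r [r0 Hr]].
  exists r. split; [exact r0|]. intros y Hy.
  assert (E : - y - - z = - (y - z)) by ring.
  specialize (Hr (- y)). rewrite E, Cmod_opp in Hr. specialize (Hr Hy).
  now replace (- d * (y - z)) with (d * - (y - z)) by ring.
Qed.

(** * Meromorphic functions under sums and translations *)

Lemma Cderivable_mult f g z :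
  Cderivable f z -> Cderivable g z -> Cderivable (fun y => f y * g y) z.
Proof.
  intros Hf Hg.
  exact (cderive_derivable _ _ _ (cderive_mult _ _ _ _ _ (derivable_cderive _ _ Hf)
                                 (derivable_cderive _ _ Hg))).
Qed.

Lemma Cderivable_plus f g z :
  Cderivable f z -> Cderivable g z -> Cderivable (fun y => f y + g y) z.
Proof.
  intros Hf Hg.
  exact (cderive_derivable _ _ _ (cderive_plus _ _ _ _ _ (derivable_cderive _ _ Hf)
                                 (derivable_cderive _ _ Hg))).
Qed.

Lemma Cderivable_const c z : Cderivable (fun _ => c) z.
Proof. exact (cderive_derivable _ _ _ (cderive_const c z)). Qed.

Lemma Cderivable_translate f a z :
  Cderivable (fun y => f (y - a)) z <-> Cderivable f (z - a).
Proof.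
  split; intros H; apply derivable_cderive in H.
  - apply (cderive_derivable _ _ (C_derive (fun y => f (y - a)) z)).
    apply (cderive_ext (fun y => f (y - - a - a))).
    + apply near_all. intros y. f_equal. ring.
    + apply (cderive_translate (fun y => f (y - a))).
      now replace (z - a - - a) with z by ring.
  - exact (cderive_derivable _ _ _ (cderive_translate _ _ _ _ H)).
Qed.

Lemma Cderivable_shift_pow p m z : Cderivable (fun y => (y - p) ^ m) z.
Proof.
  induction m as [|m IH]; simpl; [apply Cderivable_const|].
  apply (Cderivable_mult (fun y => y - p)); [|exact IH].
  apply (Cderivable_translate (fun y => y)). exact (cderive_derivable _ _ _ (cderive_id _)).
Qed.

Lemma pole_ext f g p m : (forall z, f z = g z) -> pole f p m -> pole g p m.
Proof.
  intros H [m1 [u [Hu [u0 Hf]]]]. split; [exact m1|].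
  exists u. split; [exact Hu|]. split; [exact u0|].
  apply locally'_near'. apply locally'_near' in Hf.
  apply near'_imp with (2 := Hf). intros z <-. now rewrite H.
Qed.

Lemma pole_translate f a p m : pole f (p - a) m -> pole (fun z => f (z - a)) p m.
Proof.
  intros [m1 [u [Hu [u0 Hf]]]]. split; [exact m1|].
  exists (fun z => u (z - a)). split; [|split; [exact u0|]].
  - apply locally_near. apply locally_near in Hu. apply near_translate in Hu.
    apply near_imp with (2 := Hu). intros z. apply Cderivable_translate.
  - apply locally'_near'. apply locally'_near' in Hf.
    apply (near'_translate p a) in Hf. apply near'_imp with (2 := Hf).
    intros z Hz. replace (z - p) with (z - a - (p - a)) by ring. exact Hz.
Qed.

(** Multiplying by (z - p)^m turns the regular summand into one that vanishes at p,
    so it cannot cancel the leading coefficient. *)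
Lemma pole_plus f h (k : C) p m :
  pole f p m -> k <> 0 -> near p (Cderivable h) ->
  pole (fun z => k * f z + h z) p m.
Proof.
  intros [m1 [u [Hu [u0 Hf]]]] k0 Hh. split; [exact m1|].
  exists (fun z => k * u z + (z - p) ^ m * h z). split; [|split].
  - apply locally_near. apply locally_near in Hu.
    apply near_imp with (2 := near_and _ _ _ Hu Hh). intros z [A B].
    apply Cderivable_plus; apply Cderivable_mult; try assumption.
    + apply Cderivable_const.
    + apply Cderivable_shift_pow.
  - destruct m as [|m]; [inversion m1|].
    replace (k * u p + (p - p) ^ S m * h p) with (k * u p) by (simpl; ring).
    now apply Cmult_neq_0.
  - apply locally'_near'. apply locally'_near' in Hf.
    apply near'_imp with (2 := Hf). intros z <-. ring.
Qed.

Lemma meromorphic_translate f a :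
  meromorphic f -> meromorphic (fun z => f (z - a)).
Proof.
  intros H p. destruct (H (p - a)) as [H1 H2]. split.
  - apply locally'_near'. apply locally'_near' in H1.
    apply (near'_translate p a) in H1. apply near'_imp with (2 := H1).
    intros z. apply Cderivable_translate.
  - destruct H2 as [H2|[m H2]].
    + left. now apply Cderivable_translate.
    + right. exists m. now apply pole_translate.
Qed.

Lemma mero_solution_translate R F a :
  mero_solution R F -> mero_solution R (fun x => F (x - a)).
Proof.
  intros [HF H]. split; [now apply meromorphic_translate|].
  intros z Dz. apply Cderivable_translate in Dz.
  rewrite (cderive_C_derive _ _ _ (cderive_translate _ _ _ _ (derivable_cderive _ _ Dz))).
  now apply H.
Qed.

(** Two functions that are continuous at a point and agree around it agree there,
    which settles the common regular points. *)
Lemma mero_eq_near f g :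
  (forall p, near' p (fun x => f x = g x)) -> mero_eq f g.
Proof.
  intros H. split.
  - intros p. apply locally'_near'. apply H.
  - intros z Df Dg. apply derivable_cderive, cderive_cont in Df, Dg.
    apply (clim_unique f z); [exact Df|].
    apply (clim_ext g); [|exact Dg]. apply near'_imp with (2 := H z). auto.
Qed.

(** * Functions along a segment *)

Definition seg (a b : C) (t : R) : C := a + t * (b - a).

Definition ccont (f : C -> C) (z : C) : Prop := clim f z (f z).

Lemma seg_0 a b : seg a b 0 = a.
Proof. unfold seg. ring. Qed.

Lemma seg_1 a b : seg a b 1 = b.
Proof. unfold seg. ring. Qed.

Lemma seg_dist a b s t :
  Cmod (seg a b s - seg a b t) = (Rabs (s - t) * Cmod (b - a))%R.
Proof.
  unfold seg. rewrite <- Cmod_R, <- Cmod_mult. f_equal.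
  rewrite RtoC_minus. ring.
Qed.

Lemma seg_ball p a b r t :
  (Cmod (a - p) < r)%R -> (Cmod (b - p) < r)%R -> (0 <= t <= 1)%R ->
  (Cmod (seg a b t - p) < r)%R.
Proof.
  intros Ha Hb Ht.
  replace (seg a b t - p) with (RtoC (1 - t) * (a - p) + t * (b - p))
    by (unfold seg; rewrite RtoC_minus; ring).
  eapply Rle_lt_trans; [apply Cmod_triangle|].
  rewrite !Cmod_mult, !Cmod_R, !Rabs_pos_eq by lra.
  destruct (Req_dec t 0) as [->|]; nra.
Qed.

Lemma seg_near a b t P :
  near (seg a b t) P -> locally t (fun s => P (seg a b s)).
Proof.
  intros [d [d0 H]].
  assert (HK : (0 < Cmod (b - a) + 1)%R) by (pose proof (Cmod_ge_0 (b - a)); lra).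
  assert (r0 : (0 < d / (Cmod (b - a) + 1))%R) by now apply Rdiv_lt_0_compat.
  exists (mkposreal _ r0). intros s Hs. apply H. rewrite seg_dist.
  change (Rabs (s - t) < d / (Cmod (b - a) + 1))%R in Hs.
  apply Rle_lt_trans with (Rabs (s - t) * (Cmod (b - a) + 1))%R.
  - apply Rmult_le_compat_l; [apply Rabs_pos | lra].
  - apply Rlt_le_trans with (d / (Cmod (b - a) + 1) * (Cmod (b - a) + 1))%R.
    + apply Rmult_lt_compat_r; lra.
    + right. field. lra.
Qed.

Lemma ccont_near f z eps :
  ccont f z -> (0 < eps)%R -> near z (fun y => (Cmod (f y - f z) < eps)%R).
Proof.
  intros H e0. apply near'_near; [|exact (H eps e0)].
  replace (f z - f z) with (RtoC 0) by ring. now rewrite Cmod_0.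
Qed.

Lemma seg_continuity f w a b t :
  ccont f (seg a b t) -> continuity_pt (fun s => Re (w * f (seg a b s))) t.
Proof.
  intros H. apply continuity_pt_locally. intros eps.
  assert (HK : (0 < Cmod w + 1)%R) by (pose proof (Cmod_ge_0 w); lra).
  assert (r0 : (0 < eps / (Cmod w + 1))%R).
  { apply Rdiv_lt_0_compat; [apply cond_pos | exact HK]. }
  refine (filter_imp _ _ _ (seg_near _ _ _ _ (ccont_near _ _ _ H r0))).
  intros s Hs.
  replace (Re (w * f (seg a b s)) - Re (w * f (seg a b t)))%R
    with (Re (w * (f (seg a b s) - f (seg a b t)))) by (simpl; ring).
  eapply Rle_lt_trans; [apply re_le_Cmod|]. rewrite Cmod_mult.
  pose proof (Cmod_ge_0 (f (seg a b s) - f (seg a b t))).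
  apply Rle_lt_trans with ((Cmod w + 1) * Cmod (f (seg a b s) - f (seg a b t)))%R.
  { apply Rmult_le_compat_r; lra. }
  apply Rlt_le_trans with ((Cmod w + 1) * (eps / (Cmod w + 1)))%R.
  { apply Rmult_lt_compat_l; lra. }
  right. field. lra.
Qed.

Lemma seg_derive f d w a b t :
  cderive f (seg a b t) d ->
  is_derive (fun s => Re (w * f (seg a b s))) t (Re (w * d * (b - a))).
Proof.
  intros H. apply is_derive_Reals. intros eps e0.
  set (K := (Cmod w * Cmod (b - a) + 1)%R).
  assert (HK : (0 < K)%R).
  { pose proof (Rmult_le_pos _ _ (Cmod_ge_0 w) (Cmod_ge_0 (b - a))). unfold K; lra. }
  assert (r0 : (0 < eps / K)%R) by now apply Rdiv_lt_0_compat.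
  destruct (seg_near _ _ _ _ (proj1 (cderive_bound _ _ _) H _ r0)) as [r Hr].
  exists r. intros h h0 Hh.
  assert (B : ball t r (t + h)%R).
  { change (Rabs (t + h - t) < r)%R. now replace (t + h - t)%R with h by ring. }
  specialize (Hr _ B). cbv beta in Hr.
  assert (E : seg a b (t + h) - seg a b t = h * (b - a)).
  { unfold seg. rewrite RtoC_plus. ring. }
  rewrite E in Hr.
  set (X := f (seg a b (t + h)) - f (seg a b t) - d * (h * (b - a))) in Hr.
  replace ((Re (w * f (seg a b (t + h))) - Re (w * f (seg a b t))) / h
             - Re (w * d * (b - a)))%R with (Re (w * X) / h)%R.
  2: { unfold X. simpl. field. exact h0. }
  assert (Hh0 : (0 < Rabs h)%R) by now apply Rabs_pos_lt.
  unfold Rdiv. rewrite Rabs_mult, Rabs_inv.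
  apply Rmult_lt_reg_r with (1 := Hh0).
  rewrite Rmult_assoc, Rinv_l, Rmult_1_r by lra.
  eapply Rle_lt_trans; [apply re_le_Cmod|]. rewrite Cmod_mult.
  apply Rle_lt_trans with (Cmod w * (eps / K * Cmod (h * (b - a))))%R.
  { apply Rmult_le_compat_l; [apply Cmod_ge_0 | exact Hr]. }
  rewrite Cmod_mult, Cmod_R.
  replace (Cmod w * (eps / K * (Rabs h * Cmod (b - a))))%R
    with (eps / K * (Cmod w * Cmod (b - a)) * Rabs h)%R by ring.
  apply Rmult_lt_compat_r; [exact Hh0|].
  apply Rlt_le_trans with (eps / K * K)%R; [|right; field; lra].
  apply Rmult_lt_compat_l; [exact r0 | unfold K; lra].
Qed.

Lemma Re_rotate (z : C) : exists w, Cmod w = 1%R /\ Re (w * z) = Cmod z.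
Proof.
  destruct (classic (z = 0)) as [->|Hz].
  - exists 1. rewrite Cmod_1, Cmod_0. split; [reflexivity | simpl; ring].
  - assert (H0 : (0 < Cmod z)%R) by now apply Cmod_gt_0.
    exists (Cconj z / Cmod z). assert (Hc : RtoC (Cmod z) <> 0).
    { intros E. apply RtoC_inj in E. lra. }
    split.
    + rewrite Cmod_div, Cmod_conj, Cmod_R, Rabs_pos_eq by (auto; lra).
      field. lra.
    + replace (Cconj z / Cmod z * z) with (RtoC (Cmod z)); [reflexivity|].
      replace (Cconj z / Cmod z * z) with (z * Cconj z / Cmod z)
        by (field; exact Hc).
      rewrite <- Cmod2_conj, RtoC_pow. field. exact Hc.
Qed.

(** Rotating the increment of f to the positive real axis reduces this to the real
    mean value theorem. Differentiability is asked for only between a and b, so that a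
    or b may be a point where nothing but continuity is known. *)
Lemma mean_value f f' a b K :
  (forall t, (0 <= t <= 1)%R -> ccont f (seg a b t)) ->
  (forall t, (0 < t < 1)%R ->
     cderive f (seg a b t) (f' (seg a b t)) /\ (Cmod (f' (seg a b t)) <= K)%R) ->
  (Cmod (f b - f a) <= K * Cmod (b - a))%R.
Proof.
  intros Hc Hd. destruct (Re_rotate (f b - f a)) as [w [Hw1 Hw]].
  set (df := fun s : R => if Rlt_dec 0 s then if Rlt_dec s 1
                  then Re (w * f' (seg a b s) * (b - a)) else 0%R else 0%R).
  assert (K0 : (0 <= K)%R).
  { eapply Rle_trans; [apply Cmod_ge_0|]. apply (Hd (/ 2)%R). lra. }
  destruct (MVT_gen (fun s => Re (w * f (seg a b s))) 0 1 df) as [c [_ E]].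
  - rewrite Rmin_left, Rmax_right by lra. intros t Ht. unfold df.
    destruct (Rlt_dec 0 t); [|lra]. destruct (Rlt_dec t 1); [|lra].
    apply seg_derive. now apply Hd.
  - rewrite Rmin_left, Rmax_right by lra. intros t Ht.
    apply seg_continuity. now apply Hc.
  - cbv beta in E. rewrite seg_0, seg_1 in E. rewrite <- Hw.
    replace (Re (w * (f b - f a))) with (Re (w * f b) - Re (w * f a))%R
      by (simpl; ring).
    rewrite E, Rminus_0_r, Rmult_1_r. unfold df.
    assert (H0 : (0 <= K * Cmod (b - a))%R)
      by (apply Rmult_le_pos; [exact K0 | apply Cmod_ge_0]).
    destruct (Rlt_dec 0 c); [|exact H0]. destruct (Rlt_dec c 1); [|exact H0].
    eapply Rle_trans; [apply Rle_abs|]. eapply Rle_trans; [apply re_le_Cmod|].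
    rewrite !Cmod_mult, Hw1, Rmult_1_l.
    apply Rmult_le_compat_r; [apply Cmod_ge_0|]. apply Hd. lra.
Qed.

(** The derivative of a real function cannot change sign without vanishing,
    even if it is not continuous: the maximum of the function would be interior. *)
Lemma derivative_keeps_sign (g g' : R -> R) :
  (forall t, (0 <= t <= 1)%R -> is_derive g t (g' t)) ->
  (forall t, (0 <= t <= 1)%R -> g' t <> 0%R) ->
  (0 < g' 0)%R -> (0 < g' 1)%R.
Proof.
  intros Hd Hn H0. apply Rnot_le_lt. intros H1.
  assert (H1' : (g' 1 < 0)%R).
  { destruct H1 as [H1|H1]; [exact H1|]. now elim (Hn 1%R); [lra|]. }
  assert (Hc : forall t, (0 <= t <= 1)%R -> continuity_pt g t).
  { intros t Ht. apply derivable_continuous_pt. exists (g' t).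
    apply is_derive_Reals. now apply Hd. }
  destruct (continuity_ab_maj g 0 1 (ltac:(lra)) Hc) as [m [Hm Hm1]].
  (* The slope of g near t has the sign of g' t. *)
  assert (Hs : forall t, (0 <= t <= 1)%R -> exists r, (0 < r)%R /\
            forall h, h <> 0%R -> (Rabs h < r)%R ->
            (0 < (g (t + h) - g t) / h * g' t)%R).
  { intros t Ht. pose proof (proj1 (is_derive_Reals _ _ _) (Hd t Ht)) as D.
    assert (e0 : (0 < Rabs (g' t))%R) by now apply Rabs_pos_lt, Hn.
    destruct (D _ e0) as [r Hr]. exists r. split; [apply cond_pos|].
    intros h h0 Hh. specialize (Hr h h0 Hh).
    set (x := ((g (t + h) - g t) / h)%R) in *.
    destruct (Rcase_abs (g' t)) as [N|N].
    - rewrite (Rabs_left _ N) in Hr. apply Rabs_def2 in Hr. nra.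
    - pose proof (Hn t Ht). rewrite (Rabs_right _ N) in Hr.
      apply Rabs_def2 in Hr. nra. }
  destruct (Hs m Hm1) as [r [r0 Hr]].
  assert (Hmove : forall h, (0 <= m + h <= 1)%R -> h <> 0%R -> (Rabs h < r)%R ->
            (h * g' m < 0)%R).
  { intros h Hh h0 Hhr. specialize (Hr h h0 Hhr). specialize (Hm _ Hh).
    assert (E : (g (m + h) - g m = h * ((g (m + h) - g m) / h))%R)
      by (field; exact h0).
    set (x := ((g (m + h) - g m) / h)%R) in *.
    assert (Hx : (h * x <= 0)%R) by lra.
    assert (Hx0 : x <> 0%R) by (intros E0; rewrite E0 in Hr; lra).
    destruct (Rtotal_order h 0) as [A|[A|A]]; [|easy|].
    - assert (0 < x)%R by nra. assert (0 < g' m)%R by nra. nra.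
    - assert (x < 0)%R by nra. assert (g' m < 0)%R by nra. nra. }
  assert (Hlt : forall h, (0 < h)%R -> (Rabs h = h /\ Rabs (- h) = h)%R).
  { intros h Hh. rewrite Rabs_Ropp, Rabs_pos_eq by lra. easy. }
  destruct (Req_dec m 0) as [->|m0].
  - specialize (Hmove (Rmin r 1 / 2)%R).
    assert (0 < Rmin r 1)%R by (apply Rmin_glb_lt; lra).
    pose proof (Rmin_l r 1). pose proof (Rmin_r r 1).
    destruct (Hlt (Rmin r 1 / 2)%R) as [E _]; [lra|]. rewrite E in Hmove.
    assert (Rmin r 1 / 2 * g' 0 < 0)%R by (apply Hmove; lra). nra.
  - destruct (Req_dec m 1) as [->|m1].
    + specialize (Hmove (- (Rmin r 1 / 2))%R).
      assert (0 < Rmin r 1)%R by (apply Rmin_glb_lt; lra).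
      pose proof (Rmin_l r 1). pose proof (Rmin_r r 1).
      destruct (Hlt (Rmin r 1 / 2)%R) as [_ E]; [lra|]. rewrite E in Hmove.
      assert (- (Rmin r 1 / 2) * g' 1 < 0)%R by (apply Hmove; lra). nra.
    + set (h := (Rmin r (Rmin m (1 - m)) / 2)%R).
      assert (Hp : (0 < Rmin r (Rmin m (1 - m)))%R)
        by (repeat apply Rmin_glb_lt; lra).
      pose proof (Rmin_l r (Rmin m (1 - m))). pose proof (Rmin_r r (Rmin m (1 - m))).
      pose proof (Rmin_l m (1 - m)). pose proof (Rmin_r m (1 - m)).
      destruct (Hlt h) as [E1 E2]; [unfold h; lra|].
      assert (h * g' m < 0)%R by (apply Hmove; rewrite ?E1; unfold h; lra).
      assert (- h * g' m < 0)%R by (apply Hmove; rewrite ?E2; unfold h; lra).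
      lra.
Qed.

Lemma first_zero (h : C -> C) a b :
  (forall t, (0 <= t <= 1)%R -> ccont h (seg a b t)) ->
  h a <> 0 -> h b = 0 ->
  exists t, (0 < t <= 1)%R /\ h (seg a b t) = 0 /\
    forall s, (0 <= s < t)%R -> h (seg a b s) <> 0.
Proof.
  intros Hc Ha Hb.
  set (S := fun t : R => (0 <= t <= 1)%R /\
              forall s, (0 <= s <= t)%R -> h (seg a b s) <> 0).
  assert (S0 : S 0%R).
  { split; [lra|]. intros s Hs. replace s with 0%R by lra. now rewrite seg_0. }
  destruct (completeness S) as [m [Hub Hlub]].
  - exists 1%R. intros t [Ht _]. lra.
  - now exists 0%R.
  - assert (Hm0 : (0 <= m)%R) by now apply Hub.
    assert (Hm1 : (m <= 1)%R) by (apply Hlub; intros t [Ht _]; lra).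
    assert (Hbefore : forall s, (0 <= s < m)%R -> h (seg a b s) <> 0).
    { intros s Hs Es. assert (m <= s)%R; [|lra].
      apply Hlub. intros t [Ht Hts]. apply Rnot_lt_le. intros Hlt.
      apply (Hts s); [lra | exact Es]. }
    assert (Hzero : h (seg a b m) = 0).
    { apply NNPP. intros Hne.
      assert (e0 : (0 < Cmod (h (seg a b m)))%R) by now apply Cmod_gt_0.
      destruct (seg_near _ _ _ _ (ccont_near _ _ _ (Hc m (conj Hm0 Hm1)) e0))
        as [r Hr].
      assert (Hrn : forall s, (Rabs (s - m) < r)%R -> h (seg a b s) <> 0).
      { intros s Hs Es. specialize (Hr s Hs). cbv beta in Hr. rewrite Es in Hr.
        replace (0 - h (seg a b m)) with (- h (seg a b m)) in Hr by ring.
        rewrite Cmod_opp in Hr. lra. }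
      assert (Hm1' : (m < 1)%R).
      { destruct Hm1 as [|E]; [easy|]. rewrite E, seg_1 in Hne. easy. }
      pose proof (cond_pos r).
      assert (Hp : (0 < Rmin r (1 - m))%R) by (apply Rmin_glb_lt; lra).
      pose proof (Rmin_l r (1 - m)). pose proof (Rmin_r r (1 - m)).
      assert (m + Rmin r (1 - m) / 2 <= m)%R; [|lra].
      apply Hub. split; [lra|]. intros s Hs.
      destruct (Rlt_dec s m); [apply Hbefore; lra|].
      apply Hrn. rewrite Rabs_pos_eq by lra. lra. }
    exists m. split; [|split; assumption]. split; [|exact Hm1].
    destruct Hm0 as [|E]; [easy|]. rewrite <- E, seg_0 in Hzero. easy.
Qed.

(** * Uniqueness for linear differential systems *)

Lemma gronwall_R (N N' : R -> R) L :
  (forall t, (0 <= t <= 1)%R -> is_derive N t (N' t) /\ (N' t <= L * N t)%R) ->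
  (N 1%R <= N 0%R * exp L)%R.
Proof.
  intros H.
  destruct (MVT_gen (fun t => N t * exp (- L * t))%R 0 1
              (fun t => (N' t - L * N t) * exp (- L * t))%R) as [c [Hc E]].
  - rewrite Rmin_left, Rmax_right by lra. intros t Ht.
    assert (Dt : is_derive N t (N' t)) by (apply H; lra).
    auto_derive; [now exists (N' t)|].
    replace (Derive (fun x : R => N x) t) with (N' t)
      by (symmetry; now apply is_derive_unique).
    ring.
  - rewrite Rmin_left, Rmax_right by lra. intros t Ht.
    apply derivable_continuous_pt.
    assert (Dt : is_derive N t (N' t)) by (apply H; lra).
    apply ex_derive_Reals_0. auto_derive. now exists (N' t).
  - rewrite Rmin_left, Rmax_right in Hc by lra.
    rewrite Rmult_0_r, exp_0, Rmult_1_r, Rmult_1_r, Rminus_0_r in E.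
    assert (Hn : ((N' c - L * N c) * exp (- L * c) <= 0)%R).
    { pose proof (exp_pos (- L * c)). pose proof (proj2 (H c Hc)). nra. }
    assert (H1 : (N 1%R * exp (- L) <= N 0%R)%R) by lra.
    replace (N 1%R) with (N 1%R * exp (- L) * exp L)%R.
    + apply Rmult_le_compat_r; [left; apply exp_pos | exact H1].
    + rewrite Rmult_assoc, <- exp_plus, Rplus_opp_l, exp_0. ring.
Qed.

Lemma seg_derive_norm f d a b t :
  cderive f (seg a b t) d ->
  is_derive (fun s => Cmod (f (seg a b s)) ^ 2)%R t
    (2 * Re (Cconj (f (seg a b t)) * d * (b - a)))%R.
Proof.
  intros H.
  apply (is_derive_ext
    (fun s => Re (1 * f (seg a b s)) ^ 2 + Re (- Ci * f (seg a b s)) ^ 2)%R).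
  { intros s. rewrite Cmod2_alt. unfold Re, Im. simpl.
    match goal with |- ?x = ?y => change (@eq R x y) end. ring. }
  pose proof (seg_derive f d 1 a b t H) as D1.
  pose proof (seg_derive f d (- Ci) a b t H) as D2.
  set (g1 := fun s => Re (1 * f (seg a b s))) in *.
  set (g2 := fun s => Re (- Ci * f (seg a b s))) in *.
  apply (is_derive_ext (fun s => g1 s ^ 2 + g2 s ^ 2)%R); [reflexivity|].
  auto_derive.
  - split; [eexists; exact D1|]. split; [eexists; exact D2 | exact I].
  - replace (Derive (fun x : R => g1 x) t) with (Re (1 * d * (b - a)))
      by (symmetry; now apply is_derive_unique).
    replace (Derive (fun x : R => g2 x) t) with (Re (- Ci * d * (b - a)))
      by (symmetry; now apply is_derive_unique).
    unfold g1, g2. simpl. ring.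
Qed.

(** The sum N of the three squared moduli satisfies N' <= L N along the segment and
    vanishes at its origin. *)
Lemma gronwall (y1 y2 y3 d1 d2 d3 : C -> C) a b K :
  (forall t, (0 <= t <= 1)%R -> let z := seg a b t in
     let S := (Cmod (y1 z) + Cmod (y2 z) + Cmod (y3 z))%R in
     (cderive y1 z (d1 z) /\ (Cmod (d1 z) <= K * S)%R) /\
     (cderive y2 z (d2 z) /\ (Cmod (d2 z) <= K * S)%R) /\
     (cderive y3 z (d3 z) /\ (Cmod (d3 z) <= K * S)%R)) ->
  y1 a = 0 -> y2 a = 0 -> y3 a = 0 ->
  y1 b = 0 /\ y2 b = 0 /\ y3 b = 0.
Proof.
  intros H a1 a2 a3.
  set (N := fun t => (Cmod (y1 (seg a b t)) ^ 2 + Cmod (y2 (seg a b t)) ^ 2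
                      + Cmod (y3 (seg a b t)) ^ 2)%R).
  set (D := fun (y d : C -> C) t =>
         (2 * Re (Cconj (y (seg a b t)) * d (seg a b t) * (b - a)))%R).
  assert (HN : (N 1%R <= 0)%R).
  { replace 0%R with (N 0%R * exp (6 * Rmax K 0 * Cmod (b - a)))%R
      by (unfold N; rewrite seg_0, a1, a2, a3, Cmod_0; ring).
    apply (gronwall_R N (fun t => D y1 d1 t + D y2 d2 t + D y3 d3 t)%R
             (6 * Rmax K 0 * Cmod (b - a))%R).
    intros t Ht. destruct (H t Ht) as [[D1 B1] [[D2 B2] [D3 B3]]]. split.
    - apply seg_derive_norm in D1, D2, D3. unfold N.
      exact (is_derive_plus _ _ _ _ _ (is_derive_plus _ _ _ _ _ D1 D2) D3).
    - unfold D, N. set (z := seg a b t) in *.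
      set (S := (Cmod (y1 z) + Cmod (y2 z) + Cmod (y3 z))%R) in *.
      pose proof (Cmod_ge_0 (y1 z)). pose proof (Cmod_ge_0 (y2 z)).
      pose proof (Cmod_ge_0 (y3 z)).
      assert (S0 : (0 <= S)%R) by (unfold S; lra).
      assert (X : forall u d, (Cmod d <= K * S)%R ->
         (2 * Re (Cconj u * d * (b - a)) <=
          Cmod u * (2 * (Rmax K 0 * S) * Cmod (b - a)))%R).
      { intros u d Hd.
        assert (Re (Cconj u * d * (b - a)) <= Cmod u * Cmod d * Cmod (b - a))%R.
        { eapply Rle_trans; [apply Rle_abs|].
          eapply Rle_trans; [apply re_le_Cmod|].
          rewrite !Cmod_mult, Cmod_conj. lra. }
        assert (Cmod d <= Rmax K 0 * S)%R.
        { eapply Rle_trans; [exact Hd|]. apply Rmult_le_compat_r; [exact S0|].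
          apply Rmax_l. }
        assert (Cmod u * Cmod d * Cmod (b - a) <=
                Cmod u * (Rmax K 0 * S) * Cmod (b - a))%R; [|lra].
        apply Rmult_le_compat_r; [apply Cmod_ge_0|].
        apply Rmult_le_compat_l; [apply Cmod_ge_0 | assumption]. }
      pose proof (X (y1 z) _ B1). pose proof (X (y2 z) _ B2). pose proof (X (y3 z) _ B3).
      set (c := (2 * Rmax K 0 * Cmod (b - a))%R).
      assert (c0 : (0 <= c)%R).
      { unfold c. repeat apply Rmult_le_pos; try lra; [apply Rmax_r | apply Cmod_ge_0]. }
      assert (S ^ 2 <= 3 * (Cmod (y1 z) ^ 2 + Cmod (y2 z) ^ 2 + Cmod (y3 z) ^ 2))%R.
      { unfold S. pose proof (pow2_ge_0 (Cmod (y1 z) - Cmod (y2 z))).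
        pose proof (pow2_ge_0 (Cmod (y1 z) - Cmod (y3 z))).
        pose proof (pow2_ge_0 (Cmod (y2 z) - Cmod (y3 z))). nra. }
      apply Rle_trans with (c * S ^ 2)%R.
      + replace (c * S ^ 2)%R
          with ((Cmod (y1 z) + Cmod (y2 z) + Cmod (y3 z))
                 * (2 * (Rmax K 0 * S) * Cmod (b - a)))%R
          by (fold S; unfold c; ring).
        lra.
      + replace (6 * Rmax K 0 * Cmod (b - a))%R with (3 * c)%R by (unfold c; ring).
        nra. }
  unfold N in HN. rewrite seg_1 in HN.
  pose proof (pow2_ge_0 (Cmod (y1 b))). pose proof (pow2_ge_0 (Cmod (y2 b))).
  pose proof (pow2_ge_0 (Cmod (y3 b))).
  assert (X : forall u, (Cmod u ^ 2 <= 0)%R -> u = 0).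
  { intros u Hu. apply Cmod_eq_0. pose proof (Cmod_ge_0 u). nra. }
  repeat split; apply X; lra.
Qed.

Lemma growth_on_seg (y d : C -> C) a b K :
  (forall t, (0 <= t <= 1)%R -> let z := seg a b t in
     cderive y z (d z) /\ (Cmod (d z) <= K * Cmod (y z))%R) ->
  (Cmod (y b) ^ 2 <= Cmod (y a) ^ 2 * exp (2 * K * Cmod (b - a)))%R.
Proof.
  intros H.
  pose proof (gronwall_R (fun t => Cmod (y (seg a b t)) ^ 2)%R
    (fun t => 2 * Re (Cconj (y (seg a b t)) * d (seg a b t) * (b - a)))%R
    (2 * K * Cmod (b - a))%R) as G.
  cbv beta in G. rewrite seg_0, seg_1 in G. apply G.
  intros t Ht. destruct (H t Ht) as [D B]. split; [now apply seg_derive_norm|].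
  set (z := seg a b t) in *.
  assert (Re (Cconj (y z) * d z * (b - a)) <= Cmod (y z) * Cmod (d z) * Cmod (b - a))%R.
  { eapply Rle_trans; [apply Rle_abs|]. eapply Rle_trans; [apply re_le_Cmod|].
    rewrite !Cmod_mult, Cmod_conj. lra. }
  assert (Cmod (y z) * Cmod (d z) * Cmod (b - a)
          <= Cmod (y z) * (K * Cmod (y z)) * Cmod (b - a))%R; [|nra].
  apply Rmult_le_compat_r; [apply Cmod_ge_0|].
  apply Rmult_le_compat_l; [apply Cmod_ge_0 | exact B].
Qed.

(** * Connectedness of the plane *)

Lemma clopen_plane (A : C -> Prop) a :
  A a -> (forall p, A p -> near p A) ->
  (forall q, (forall d, (0 < d)%R -> exists p, A p /\ (Cmod (p - q) < d)%R) -> A q) ->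
  forall b, A b.
Proof.
  intros Aa Ho Hc b.
  set (S := fun t : R => (0 <= t <= 1)%R /\
              forall s, (0 <= s <= t)%R -> A (seg a b s)).
  assert (S0 : S 0%R).
  { split; [lra|]. intros s Hs. replace s with 0%R by lra. now rewrite seg_0. }
  destruct (completeness S) as [m [Hub Hlub]].
  - exists 1%R. intros t [Ht _]. lra.
  - now exists 0%R.
  - assert (Hm0 : (0 <= m)%R) by now apply Hub.
    assert (Hm1 : (m <= 1)%R) by (apply Hlub; intros t [Ht _]; lra).
    assert (Hbefore : forall s, (0 <= s < m)%R -> A (seg a b s)).
    { intros s Hs. apply NNPP. intros Es. assert (m <= s)%R; [|lra].
      apply Hlub. intros t [Ht Hts]. apply Rnot_lt_le. intros Hlt.
      apply Es, Hts. lra. }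
    assert (Hm : A (seg a b m)).
    { apply Hc. intros d d0.
      destruct (seg_near a b m (fun y => (Cmod (y - seg a b m) < d)%R)) as [r Hr].
      { exists d; auto. }
      pose proof (cond_pos r) as r0.
      destruct (Rle_lt_or_eq_dec _ _ Hm0) as [Hp|<-].
      - exists (seg a b (Rmax 0 (m - r / 2))). split.
        + apply Hbefore. split; [apply Rmax_l | apply Rmax_lub_lt; lra].
        + apply Hr. change (Rabs (Rmax 0 (m - r / 2) - m) < r)%R.
          pose proof (Rmax_l 0 (m - r / 2)). pose proof (Rmax_r 0 (m - r / 2)).
          assert (Rmax 0 (m - r / 2) < m)%R by (apply Rmax_lub_lt; lra).
          rewrite Rabs_left by lra. lra.
      - exists (seg a b 0). rewrite seg_0 at 1. split; [exact Aa|].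
        apply Hr. change (Rabs (0 - 0) < r)%R. rewrite Rminus_0_r, Rabs_R0. exact r0. }
    destruct (seg_near _ _ _ _ (Ho _ Hm)) as [r Hr]. pose proof (cond_pos r) as r0.
    destruct (Rle_lt_or_eq_dec _ _ Hm1) as [Hlt|E].
    2: { now rewrite E, seg_1 in Hm. }
    assert (Hp : (0 < Rmin r (1 - m))%R) by (apply Rmin_glb_lt; lra).
    pose proof (Rmin_l r (1 - m)). pose proof (Rmin_r r (1 - m)).
    assert (m + Rmin r (1 - m) / 2 <= m)%R; [|lra].
    apply Hub. split; [lra|]. intros s Hs.
    destruct (Rlt_dec s m); [apply Hbefore; lra|].
    apply Hr. change (Rabs (s - m) < r)%R. rewrite Rabs_pos_eq by lra. lra.
Qed.

(** Two points of a disc can be joined, inside the disc, by one or two segments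
    that avoid the centre: if the centre lies between them, the detour goes
    through the second point turned by a right angle. *)
Lemma join_around (p : C) r a b :
  a <> p -> b <> p -> (Cmod (a - p) < r)%R -> (Cmod (b - p) < r)%R ->
  exists m, (Cmod (m - p) < r)%R /\
    (forall t, (0 <= t <= 1)%R -> seg a m t <> p) /\
    (forall t, (0 <= t <= 1)%R -> seg m b t <> p).
Proof.
  intros Ha Hb Har Hbr.
  destruct (classic (forall t, (0 <= t <= 1)%R -> seg a b t <> p)) as [Hs|Hs].
  { exists b. split; [exact Hbr|]. split; [exact Hs|]. intros t _.
    replace (seg b b t) with b by (unfold seg; ring). exact Hb. }
  apply not_all_ex_not in Hs. destruct Hs as [t Hs].
  apply imply_to_and in Hs. destruct Hs as [Ht Hs]. apply NNPP in Hs.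
  set (u := b - p). set (m := p + Ci * u).
  assert (Hu : u <> 0) by now apply Cminus_eq_contra.
  assert (Hm : (Cmod (m - p) < r)%R).
  { replace (m - p) with (Ci * u) by (unfold m; ring).
    rewrite Cmod_mult, Cmod_Ci, Rmult_1_l. exact Hbr. }
  assert (Ht1 : (t < 1)%R).
  { destruct (Rle_lt_or_eq_dec t 1 (proj2 Ht)) as [|E]; [easy|].
    rewrite E, seg_1 in Hs. easy. }
  assert (Ht0 : (0 < t)%R).
  { destruct (Rle_lt_or_eq_dec 0 t (proj1 Ht)) as [|E]; [easy|].
    rewrite <- E, seg_0 in Hs. easy. }
  assert (Ha' : a - p = - (t / (1 - t)) * u).
  { assert (H1 : RtoC (1 - t) <> 0) by (intros E; apply RtoC_inj in E; lra).
    rewrite RtoC_minus in H1.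
    assert (E : a = (p - t * b) / (1 - t)).
    { rewrite <- Hs. unfold seg. field. exact H1. }
    rewrite E. unfold u. field. exact H1. }
  assert (Hnz : forall x y : R, (x, y) <> (0%R, 0%R) -> (x + Ci * y) * u <> 0).
  { intros x y Hxy. apply Cmult_neq_0; [|exact Hu]. intros E. apply Hxy.
    assert (E1 := f_equal fst E). assert (E2 := f_equal snd E). simpl in E1, E2.
    f_equal; lra. }
  exists m. split; [exact Hm|]. split.
  - intros s Hs' Es. apply (Hnz (- (1 - s) * (t / (1 - t)))%R s).
    + intros E. injection E as E1 E2. subst s.
      assert (0 < t / (1 - t))%R by (apply Rdiv_lt_0_compat; lra). nra.
    + transitivity (seg a m s - p); [|rewrite Es; ring].
      replace (seg a m s - p) with ((1 - s) * (a - p) + s * (m - p))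
        by (unfold seg; ring).
      rewrite Ha'. unfold m.
      rewrite RtoC_mult, RtoC_opp, RtoC_minus, RtoC_div, RtoC_minus by lra. ring.
  - intros s Hs' Es. apply (Hnz s (1 - s)%R).
    + intros E. injection E as E1 E2. lra.
    + transitivity (seg m b s - p); [|rewrite Es; ring].
      replace (seg m b s - p) with ((1 - s) * (m - p) + s * u)
        by (unfold seg, u; ring).
      unfold m. rewrite RtoC_minus. ring.
Qed.

Lemma punctured_variation (g g' : C -> C) p r K :
  (forall y, y <> p -> (Cmod (y - p) < r)%R ->
     cderive g y (g' y) /\ (Cmod (g' y) <= K)%R) ->
  forall a b, a <> p -> b <> p -> (Cmod (a - p) < r)%R -> (Cmod (b - p) < r)%R ->
  (Cmod (g b - g a) <= 4 * K * r)%R.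
Proof.
  intros H a b Ha Hb Har Hbr.
  assert (K0 : (0 <= K)%R).
  { eapply Rle_trans; [apply Cmod_ge_0 | apply (H a Ha Har)]. }
  destruct (join_around p r a b Ha Hb Har Hbr) as [m [Hm [Ham Hmb]]].
  assert (X : forall u v, (Cmod (u - p) < r)%R -> (Cmod (v - p) < r)%R ->
            (forall t, (0 <= t <= 1)%R -> seg u v t <> p) ->
            (Cmod (g v - g u) <= 2 * K * r)%R).
  { intros u v Hu Hv Huv.
    assert (HD : forall t, (0 <= t <= 1)%R -> cderive g (seg u v t) (g' (seg u v t)) /\
                   (Cmod (g' (seg u v t)) <= K)%R).
    { intros t Ht. apply H; [now apply Huv | now apply seg_ball]. }
    apply Rle_trans with (K * Cmod (v - u))%R.
    - apply (mean_value g g'); intros t Ht.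
      + exact (cderive_cont _ _ _ (proj1 (HD t Ht))).
      + apply HD. lra.
    - assert (Cmod (v - u) <= 2 * r)%R.
      { replace (v - u) with ((v - p) + - (u - p)) by ring.
        eapply Rle_trans; [apply Cmod_triangle|]. rewrite Cmod_opp. lra. }
      nra. }
  pose proof (X a m Har Hm Ham). pose proof (X m b Hm Hbr Hmb).
  replace (g b - g a) with ((g b - g m) + (g m - g a)) by ring.
  eapply Rle_trans; [apply Cmod_triangle | lra].
Qed.

Lemma bounded_on_seg (g : C -> C) a b :
  (forall t, (0 <= t <= 1)%R -> ccont g (seg a b t)) ->
  exists K, forall t, (0 <= t <= 1)%R -> (Cmod (g (seg a b t)) <= K)%R.
Proof.
  intros H.
  assert (X : forall w : C, exists K, forall t, (0 <= t <= 1)%R ->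
            (Re (w * g (seg a b t)) <= K)%R).
  { intros w. destruct (continuity_ab_maj (fun t => Re (w * g (seg a b t))) 0 1)
      as [m [Hm _]]; [lra| |].
    - intros t Ht. now apply seg_continuity, H.
    - eexists. exact Hm. }
  destruct (X 1) as [K1 H1]. destruct (X (-1)) as [K2 H2].
  destruct (X Ci) as [K3 H3]. destruct (X (- Ci)) as [K4 H4].
  exists (Rmax K1 K2 + Rmax K3 K4)%R. intros t Ht.
  specialize (H1 t Ht). specialize (H2 t Ht). specialize (H3 t Ht). specialize (H4 t Ht).
  destruct (g (seg a b t)) as [x y]. simpl in H1, H2, H3, H4.
  replace (x, y) with (RtoC x + Ci * y) by
    (apply injective_projections; simpl; ring).
  eapply Rle_trans; [apply Cmod_triangle|].
  rewrite Cmod_mult, Cmod_Ci, !Cmod_R, Rmult_1_l.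
  pose proof (Rmax_l K1 K2). pose proof (Rmax_r K1 K2).
  pose proof (Rmax_l K3 K4). pose proof (Rmax_r K3 K4).
  apply Rplus_le_compat; apply Rabs_le; lra.
Qed.

Lemma zero_near_limit g p :
  near' p (fun x => cderive g x 0) -> clim g p 0 -> near' p (fun x => g x = 0).
Proof.
  intros [r [r0 Hr]] L. exists r. split; [exact r0|]. intros x Hx Hx0.
  apply NNPP. intros N. apply Cmod_gt_0 in N.
  assert (Hball : near' p (fun y => (Cmod (y - p) < r)%R)).
  { apply near_near'. now exists r. }
  destruct (near'_exists _ _ (near'_and _ _ _ (L _ N) Hball) 1 Rlt_0_1)
    as [y [Hy0 [_ [Hsmall Hyr]]]].
  assert (V : (Cmod (g x - g y) <= 4 * 0 * r)%R).
  { apply (punctured_variation g (fun _ => 0) p); try assumption.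
    intros u Hu0 Hur. split; [now apply Hr | rewrite Cmod_0; lra]. }
  replace (g y - 0) with (g y) in Hsmall by ring.
  assert (Cmod (g x) <= Cmod (g x - g y) + Cmod (g y))%R; [|lra].
  replace (g x) with ((g x - g y) + g y) at 1 by ring.
  apply Cmod_triangle.
Qed.

(** * Poles *)

(** The form in which a pole enters the estimates. *)
Definition to_inf (f : C -> C) (p : C) : Prop :=
  forall A : R, near' p (fun z => (A < Cmod (f z))%R).

Lemma pole_to_inf f p m : pole f p m -> to_inf f p.
Proof.
  intros [m1 [g [Hg [gp Hfg]]]] A.
  apply locally_near, near_at in Hg. apply locally'_near' in Hfg.
  apply derivable_cderive, cderive_cont in Hg.
  assert (g0 : (0 < Cmod (g p) / 2)%R).
  { apply Cmod_gt_0 in gp. lra. }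
  set (B := (Rmax A 0 + 1)%R).
  assert (HB : (0 < B)%R) by (unfold B; pose proof (Rmax_r A 0); lra).
  assert (r0 : (0 < Rmin 1 (Cmod (g p) / 2 / B))%R).
  { apply Rmin_glb_lt; [lra | now apply Rdiv_lt_0_compat]. }
  assert (Hd : near' p (fun z => (Cmod (z - p) < Rmin 1 (Cmod (g p) / 2 / B))%R)).
  { apply near_near'. now exists (Rmin 1 (Cmod (g p) / 2 / B)). }
  refine (near'_imp _ _ _ _
    (near'_and _ _ _ (near'_and _ _ _ (clim_far _ _ _ _ Hg gp) Hfg) Hd)).
  intros z [[Hz E] Hzd].
  replace (g p - 0) with (g p) in Hz by ring. replace (g z - 0) with (g z) in Hz by ring.
  pose proof (Rmin_l 1 (Cmod (g p) / 2 / B)).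
  pose proof (Rmin_r 1 (Cmod (g p) / 2 / B)).
  rewrite <- E, Cmod_mult, Cmod_pow in Hz.
  pose proof (Cmod_ge_0 (z - p)) as P0. pose proof (Cmod_ge_0 (f z)) as F0.
  assert (Hpow : (Cmod (z - p) ^ m <= Cmod (z - p))%R).
  { destruct m as [|m]; [inversion m1|]. simpl.
    assert (Cmod (z - p) ^ m <= 1)%R.
    { rewrite <- (pow1 m). apply pow_incr. lra. }
    nra. }
  apply Rlt_le_trans with B; [unfold B; pose proof (Rmax_l A 0); lra|].
  apply Rnot_lt_le. intros Hlt.
  assert (Cmod (z - p) * B < Cmod (g p) / 2)%R.
  { apply Rlt_le_trans with (Cmod (g p) / 2 / B * B)%R.
    - apply Rmult_lt_compat_r; lra.
    - right. field. lra. }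
  nra.
Qed.

Lemma to_inf_not_clim f p l : to_inf f p -> ~ clim f p l.
Proof.
  intros H Hl.
  destruct (near'_exists _ _ (near'_and _ _ _ (H (Cmod l + 1)%R) (clim_bounded _ _ _ Hl))
              1 Rlt_0_1) as [z [_ [_ [A B]]]]. lra.
Qed.

Lemma to_inf_not_derivable f p : to_inf f p -> ~ Cderivable f p.
Proof.
  intros H D. apply derivable_cderive, cderive_cont in D.
  exact (to_inf_not_clim _ _ _ H D).
Qed.

Lemma to_inf_neq f p (k : C) : to_inf f p -> near' p (fun z => f z <> k).
Proof.
  intros H. refine (near'_imp _ _ _ _ (H (Cmod k))). intros z Hz E. rewrite E in Hz. lra.
Qed.

Lemma to_inf_inv f p : to_inf f p -> clim (fun z => / f z) p 0.
Proof.
  intros H eps e0.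
  refine (near'_imp _ _ _ _ (near'_and _ _ _ (H (/ eps)%R) (to_inf_neq _ _ 0 H))).
  intros z [Hz Hn]. replace (/ f z - 0) with (/ f z) by ring.
  rewrite Cmod_inv by exact Hn.
  assert (0 < / eps)%R by now apply Rinv_0_lt_compat.
  rewrite <- (Rinv_inv eps). apply Rinv_lt_contravar; [|exact Hz].
  apply Rmult_lt_0_compat; lra.
Qed.

Lemma meromorphic_cases f p :
  meromorphic f ->
  near' p (Cderivable f) /\ (Cderivable f p \/ to_inf f p).
Proof.
  intros H. destruct (H p) as [H1 H2]. split.
  - now apply locally'_near'.
  - destruct H2 as [H2|[m Hm]]; [now left | right; exact (pole_to_inf _ _ _ Hm)].
Qed.

Lemma meromorphic_open f z :
  meromorphic f -> Cderivable f z -> near z (Cderivable f).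
Proof.
  intros H Hz. apply near'_near; [exact Hz|]. now apply meromorphic_cases.
Qed.

(** * Zeros of a function with nearly constant derivative *)

(** Both a and b make with l an angle of sine at most 1/4. *)
Lemma cone (l a b : C) :
  l <> 0 -> (Cmod (l - a) <= Cmod a / 4)%R -> (Cmod (l - b) <= Cmod b / 4)%R ->
  (0 < Re (a * Cconj b))%R.
Proof.
  intros Hl Ha Hb. apply Cmod_gt_0 in Hl.
  set (x := a - l). set (y := b - l).
  assert (X : forall u, (Cmod (l - u) <= Cmod u / 4)%R ->
                        (Cmod (u - l) <= Cmod l / 3)%R).
  { intros u Hu. replace (l - u) with (- (u - l)) in Hu by ring.
    rewrite Cmod_opp in Hu.
    assert (Cmod u <= Cmod (u - l) + Cmod l)%R; [|lra].
    replace u with ((u - l) + l) at 1 by ring. apply Cmod_triangle. }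
  apply X in Ha, Hb. fold x in Ha. fold y in Hb.
  replace (Re (a * Cconj b)) with
    (Cmod l ^ 2 + Re (x * Cconj l) + Re (l * Cconj y) + Re (x * Cconj y))%R.
  2: { rewrite Cmod2_alt. unfold x, y, Re, Im. simpl. ring. }
  assert (B : forall u v, (- (Cmod u * Cmod v) <= Re (u * Cconj v))%R).
  { intros u v. pose proof (re_le_Cmod (u * Cconj v)) as Hr.
    rewrite Cmod_mult, Cmod_conj in Hr. apply Rabs_le_between in Hr. lra. }
  pose proof (B x l). pose proof (B l y). pose proof (B x y).
  pose proof (Cmod_ge_0 x). pose proof (Cmod_ge_0 y). nra.
Qed.

(** As long as h does not vanish its increments are nearly c times those of the
    variable, so its first zero t along the segment nearly solves
    h w + c t (z - w) = 0. *)
Lemma first_zero_direction (h q : C -> C) (c w z : C) :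
  c <> 0 ->
  (forall t, (0 <= t <= 1)%R -> ccont h (seg w z t)) ->
  (forall t, (0 <= t <= 1)%R -> h (seg w z t) <> 0 ->
     cderive h (seg w z t) (q (seg w z t)) /\
     (Cmod (q (seg w z t) - c) <= Cmod c / 4)%R) ->
  h w <> 0 -> h z = 0 ->
  exists t : R, (0 < t)%R /\
    (Cmod (- h w / c - t * (z - w)) <= Cmod (t * (z - w)) / 4)%R.
Proof.
  intros Hc Hcont Hd Hw Hz.
  destruct (first_zero h w z Hcont Hw Hz) as [t [Ht [Ht0 Hbefore]]].
  exists t. split; [lra|].
  assert (Es : forall s, seg w (seg w z t) s = seg w z (s * t)).
  { intros s. unfold seg. rewrite RtoC_mult. ring. }
  assert (Hst : forall s, (0 <= s <= 1)%R -> (0 <= s * t <= 1)%R).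
  { intros s Hs. nra. }
  pose proof (mean_value (fun y => h y - c * y) (fun y => q y - c)
                w (seg w z t) (Cmod c / 4)%R) as M.
  cbv beta in M. rewrite Ht0 in M.
  assert (E : - h w / c - t * (z - w) = (0 - c * seg w z t - (h w - c * w)) / c).
  { unfold seg. field. exact Hc. }
  rewrite E, Cmod_div by exact Hc.
  assert (c0 : (0 < Cmod c)%R) by now apply Cmod_gt_0.
  apply Rmult_le_reg_r with (1 := c0). unfold Rdiv at 1.
  rewrite Rmult_assoc, Rinv_l, Rmult_1_r by lra.
  replace (seg w z t - w) with (t * (z - w)) in M by (unfold seg; ring).
  eapply Rle_trans; [apply M | right; field].
  - intros s Hs. rewrite Es. specialize (Hcont _ (Hst s Hs)).
    apply clim_minus; [exact Hcont|].
    apply clim_mult; [apply clim_const | apply clim_id].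
  - intros s Hs. rewrite Es. assert (Hs' : (0 <= s <= 1)%R) by lra.
    destruct (Hd _ (Hst s Hs')) as [D B].
    + apply Hbefore. nra.
    + split; [|exact B].
      refine (cderive_eq _ _ _ _ _
        (cderive_minus _ _ _ _ _ D (cderive_mult _ _ _ _ _ (cderive_const c _) (cderive_id _)))).
      ring.
Qed.

Section Zeros.

Variables (h q : C -> C) (c p : C) (r : R).
Hypothesis c_nz : c <> 0.
Hypothesis h_cont : forall y, (Cmod (y - p) < r)%R -> ccont h y.
Hypothesis h_deriv : forall y, (Cmod (y - p) < r)%R -> h y <> 0 ->
  cderive h y (q y) /\ (Cmod (q y - c) <= Cmod c / 4)%R.

(** From a point w where h does not vanish, every zero lies nearly in the direction
    of - h w / c. *)
Lemma zeros_seen_acutely w z z' :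
  (Cmod (w - p) < r)%R -> (Cmod (z - p) < r)%R -> (Cmod (z' - p) < r)%R ->
  h w <> 0 -> h z = 0 -> h z' = 0 ->
  (0 < Re ((z - w) * Cconj (z' - w)))%R.
Proof.
  intros Hw Hz Hz' hw hz hz'.
  assert (X : forall u, (Cmod (u - p) < r)%R -> h u = 0 ->
    exists t : R, (0 < t)%R /\
      (Cmod (- h w / c - t * (u - w)) <= Cmod (t * (u - w)) / 4)%R).
  { intros u Hu hu. apply (first_zero_direction h q); try assumption.
    - intros t Ht. apply h_cont. now apply seg_ball.
    - intros t Ht. apply h_deriv. now apply seg_ball. }
  destruct (X z Hz hz) as [t [t0 Ht]]. destruct (X z' Hz' hz') as [s [s0 Hs]].
  assert (L : - h w / c <> 0).
  { intros E. apply hw. replace (h w) with (- (- h w / c) * c) by (field; exact c_nz).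
    rewrite E. ring. }
  pose proof (cone _ _ _ L Ht Hs) as K.
  assert (E : Re (t * (z - w) * Cconj (s * (z' - w)))
          = (t * s * Re ((z - w) * Cconj (z' - w)))%R) by (simpl; ring).
  rewrite E in K. apply Rnot_le_lt. intros N.
  pose proof (Rmult_lt_0_compat _ _ t0 s0). nra.
Qed.

(** A point from which two zeros are seen under a right or obtuse angle must be a zero
    itself. This applies first to the points p + (1 + 3i) v and p + (1 - 3i) v with
    v = (z - p) / 10, which lie on the circle of diameter [p, z], and then to the points
    of the ball, from which these two are seen under an obtuse angle. *)
Lemma two_zeros_fill_ball z :
  h p = 0 -> h z = 0 -> z <> p -> (Cmod (z - p) < r)%R ->
  forall w, (Cmod (w - p) < Cmod (z - p) / 10)%R -> h w = 0.
Proof.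
  intros hp hz Hne Hz.
  set (v := (z - p) / 10).
  assert (Ez : z = p + 10 * v) by (unfold v; field).
  assert (Hv : v <> 0).
  { intros E. apply Hne. rewrite Ez, E. ring. }
  apply Cmod_gt_0 in Hv.
  assert (Ev : (Cmod (z - p) = 10 * Cmod v)%R).
  { replace (z - p) with (10 * v) by (rewrite Ez; ring).
    rewrite Cmod_mult, Cmod_R, Rabs_pos_eq by lra. reflexivity. }
  assert (Hp : (Cmod (p - p) < r)%R).
  { replace (p - p) with (RtoC 0) by ring. rewrite Cmod_0. lra. }
  assert (side : forall e : R, e = 1%R \/ e = (-1)%R ->
    (Cmod (p + (1 + 3 * e * Ci) * v - p) < r)%R /\ h (p + (1 + 3 * e * Ci) * v) = 0).
  { intros e He. set (u := p + (1 + 3 * e * Ci) * v).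
    assert (Hu : (Cmod (u - p) < r)%R).
    { replace (u - p) with ((1 + 3 * e * Ci) * v) by (unfold u; ring).
      rewrite Cmod_mult.
      assert (Cmod (1 + 3 * e * Ci) <= 4)%R.
      { eapply Rle_trans; [apply Cmod_triangle|].
        rewrite !Cmod_mult, Cmod_Ci, !Cmod_R, Rabs_R1, (Rabs_pos_eq 3) by lra.
        destruct He as [-> | ->]; [rewrite Rabs_R1 | rewrite Rabs_left by lra]; lra. }
      nra. }
    split; [exact Hu|]. apply NNPP. intros hu.
    pose proof (zeros_seen_acutely u p z Hu Hp Hz hu hp hz) as K.
    replace (Re ((p - u) * Cconj (z - u))) with 0%R in K; [lra|].
    unfold u. rewrite Ez. destruct v as [v1 v2].
    destruct He as [-> | ->]; simpl; ring. }
  destruct (side 1%R (or_introl eq_refl)) as [H1 h1].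
  destruct (side (-1)%R (or_intror eq_refl)) as [H2 h2].
  intros w Hw. apply NNPP. intros hw.
  assert (Hwr : (Cmod (w - p) < r)%R) by lra.
  pose proof (zeros_seen_acutely w _ _ Hwr H1 H2 hw h1 h2) as K.
  set (x := (w - p) / v).
  assert (v0 : v <> 0) by now apply Cmod_gt_0.
  assert (Hx : (Cmod x < 1)%R).
  { unfold x. rewrite Cmod_div by exact v0.
    apply Rmult_lt_reg_r with (1 := Hv). unfold Rdiv.
    rewrite Rmult_assoc, Rinv_l by lra. lra. }
  assert (Hx2 : (Re x ^ 2 + Im x ^ 2 < 1)%R).
  { rewrite <- Cmod2_alt. pose proof (Cmod_ge_0 x). nra. }
  assert (Ew : w = p + x * v) by (unfold x; field; exact v0).
  rewrite Ew in K. destruct x as [x1 x2].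
  assert (V2 : (0 < Re v ^ 2 + Im v ^ 2)%R).
  { rewrite <- Cmod2_alt. nra. }
  destruct v as [v1 v2]. simpl in *.
  match type of K with (0 < ?k)%R => replace k
    with (((1 - x1) ^ 2 + x2 ^ 2 - 9) * (v1 * (v1 * 1) + v2 * (v2 * 1)))%R in K by ring end.
  assert ((1 - x1) ^ 2 + x2 ^ 2 - 9 < 0)%R by nra.
  nra.
Qed.

End Zeros.

(** * The differential equation of the elliptic function *)

Definition cubic (G2 G3 x : C) : C := 4 * x ^ 3 - G2 * x - G3.

Definition half_cubic' (G2 x : C) : C := 6 * x ^ 2 - G2 / 2.

Section Elliptic.

Variables (f : C -> C) (G2 G3 : C).
Hypothesis f_mero : meromorphic f.
Hypothesis f_pole : to_inf f 0.

Local Notation P := (cubic G2 G3).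
Local Notation dP := (half_cubic' G2).

Hypothesis f_ode : forall z, Cderivable f z -> C_derive f z ^ 2 = P (f z).

Local Notation f' := (C_derive f).

Lemma f_cont z : Cderivable f z -> ccont f z.
Proof. intros H. exact (cderive_cont _ _ _ (derivable_cderive _ _ H)). Qed.

Lemma P_clim g p l : clim g p l -> clim (fun z => P (g z)) p (P l).
Proof.
  intros H. unfold cubic. simpl.
  repeat first [apply clim_minus | apply clim_mult | exact H | apply clim_const].
Qed.

Lemma dP_clim g p l : clim g p l -> clim (fun z => dP (g z)) p (dP l).
Proof.
  intros H. unfold half_cubic'. simpl.
  repeat first [apply clim_minus | apply clim_mult | exact H | apply clim_const].
Qed.

Lemma P_cderive g z d : cderive g z d -> cderive (fun y => P (g y)) z (2 * dP (g z) * d).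
Proof.
  intros H.
  pose proof (cderive_mult _ _ _ _ _ H (cderive_mult _ _ _ _ _ H H)) as H3.
  pose proof (cderive_minus _ _ _ _ _ (cderive_minus _ _ _ _ _
    (cderive_mult _ _ _ _ _ (cderive_const 4 z) H3)
    (cderive_mult _ _ _ _ _ (cderive_const G2 z) H)) (cderive_const G3 z)) as K.
  refine (cderive_eq _ _ _ _ _ (cderive_ext _ _ _ _ _ K)).
  - unfold half_cubic'. simpl. field.
  - apply near_all. intros y. unfold cubic. simpl. ring.
Qed.

(** The square of f' is continuous, so f' is continuous where it vanishes; elsewhere
    it is continuous up to a sign, and a derivative cannot jump from one sign to the
    other. *)
Lemma f'_cont z : Cderivable f z -> ccont f' z.
Proof.
  intros Hz.
  pose proof (meromorphic_open _ _ f_mero Hz) as Hn.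
  assert (Hsq : clim (fun y => f' y ^ 2) z (f' z ^ 2)).
  { rewrite (f_ode z Hz).
    apply (clim_ext (fun y => P (f y))); [|now apply P_clim, f_cont].
    apply near_near'. apply near_imp with (2 := Hn). intros y Hy.
    symmetry. now apply f_ode. }
  destruct (classic (f' z = 0)) as [E|Hne].
  - unfold ccont. rewrite E in Hsq |- *. apply clim_sqr_0.
    apply (clim_eq _ _ (0 ^ 2)); [ring | exact Hsq].
  - set (s := f' z) in *.
    assert (s0 : (0 < Cmod s)%R) by now apply Cmod_gt_0.
    (* Close to z, the quotient q = f'/s satisfies |q^2 - 1| < 1/2, so q is not
       imaginary; being a derivative, Re q keeps the sign it has at z. *)
    assert (Hsq1 : near z (fun y => (Cmod ((f' y / s) ^ 2 - 1) < / 2)%R)).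
    { assert (Hc : clim (fun y => (f' y / s) ^ 2) z 1).
      { apply (clim_ext (fun y => f' y ^ 2 * (/ s ^ 2))).
        - apply near_all. intros y _. simpl. field. exact Hne.
        - apply (clim_eq _ _ (s ^ 2 * / s ^ 2)); [simpl; field; exact Hne|].
          apply (clim_mult (fun y => f' y ^ 2)); [exact Hsq | apply clim_const]. }
      apply near'_near.
      - fold s. replace ((s / s) ^ 2 - 1) with (RtoC 0) by (simpl; field; exact Hne).
        rewrite Cmod_0. lra.
      - apply Hc. lra. }
    destruct (near_and _ _ _ Hn Hsq1) as [r [r0 Hr]].
    assert (Hre : forall y, (Cmod (y - z) < r)%R -> Re (f' y / s) <> 0%R).
    { intros y Hy E. destruct (Hr y Hy) as [_ Hy2].
      destruct (f' y / s) as [u v]. simpl in E. subst u.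
      pose proof (re_le_Cmod ((0%R, v) ^ 2 - 1)) as K.
      replace (Re ((0%R, v) ^ 2 - 1)) with (- (v * v) - 1)%R in K by (simpl; ring).
      rewrite Rabs_left in K by nra. nra. }
    assert (Hz0 : (Cmod (z - z) < r)%R).
    { replace (z - z) with (RtoC 0) by ring. rewrite Cmod_0. exact r0. }
    assert (Hpos : forall y, (Cmod (y - z) < r)%R -> (0 < Re (f' y / s))%R).
    { intros y Hy. destruct (classic (y = z)) as [->|Hyz].
      { fold s. replace (s / s) with (RtoC 1) by (field; exact Hne). simpl. lra. }
      apply Cminus_eq_contra in Hyz.
      assert (Hseg : forall t, (0 <= t <= 1)%R -> (Cmod (seg z y t - z) < r)%R)
        by (intros t Ht; now apply seg_ball).
      replace y with (seg z y 1) by apply seg_1.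
      apply (derivative_keeps_sign
        (fun t => Re (/ (s * (y - z)) * f (seg z y t)))
        (fun t => Re (f' (seg z y t) / s))).
      - intros t Ht. destruct (Hr _ (Hseg t Ht)) as [D _].
        replace (f' (seg z y t) / s)
          with (/ (s * (y - z)) * f' (seg z y t) * (y - z)) by (field; auto).
        apply seg_derive. now apply derivable_cderive.
      - intros t Ht. now apply Hre, Hseg.
      - rewrite seg_0. fold s. replace (s / s) with (RtoC 1) by (field; exact Hne).
        simpl. lra. }
    apply clim_minus_0.
    intros eps e0.
    assert (e1 : (0 < eps * Cmod s)%R) by now apply Rmult_lt_0_compat.
    assert (Hr' : near' z (fun y => (Cmod (y - z) < r)%R)).
    { apply near_near'. now exists r. }
    refine (near'_imp _ _ _ _ (near'_and _ _ _ Hr' (Hsq _ e1))).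
    intros y [Hy Hy2]. replace (f' y - f' z - 0) with (f' y - s) by (fold s; ring).
    assert (Hge : (Cmod s <= Cmod (f' y + s))%R).
    { replace (f' y + s) with (s * (f' y / s + 1)) by (field; exact Hne).
      rewrite Cmod_mult. pose proof (re_le_Cmod (f' y / s + 1)) as K.
      specialize (Hpos y Hy).
      replace (Re (f' y / s + 1)) with (Re (f' y / s) + 1)%R in K by (simpl; ring).
      rewrite Rabs_pos_eq in K by lra. nra. }
    replace (f' y ^ 2 - s ^ 2) with ((f' y - s) * (f' y + s)) in Hy2 by (simpl; ring).
    rewrite Cmod_mult in Hy2. pose proof (Cmod_ge_0 (f' y - s)). nra.
Qed.

(** The difference quotient of f'^2 is that of f' times f' y + f' z, and f'^2 is the
    cubic in f. *)
Lemma f''_off_zeros z : Cderivable f z -> f' z <> 0 -> cderive f' z (dP (f z)).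
Proof.
  intros Hz Hne.
  pose proof (meromorphic_open _ _ f_mero Hz) as Hn.
  pose proof (f'_cont _ Hz) as Hc.
  pose proof (P_cderive _ _ _ (derivable_cderive _ _ Hz)) as HP.
  assert (H2 : f' z + f' z <> 0).
  { intros E. apply Hne. replace (f' z) with ((f' z + f' z) / 2) by field.
    rewrite E. field. }
  pose proof (clim_plus _ _ _ _ _ Hc (clim_const (f' z) z)) as Hs.
  pose proof (clim_div _ _ _ _ _ H2 HP Hs) as K.
  refine (clim_eq _ _ _ _ _ (clim_ext _ _ _ _ _ K)).
  - simpl. field. auto.
  - pose proof (clim_neq _ _ _ _ Hs H2) as Hs0.
    refine (near_imp _ _ _ _ (near_and _ _ _ Hn Hs0)).
    intros y [Hy Hy0] Hyz. specialize (Hy0 Hyz). cbv beta in *.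
    apply Cminus_eq_contra in Hyz.
    rewrite <- (f_ode y Hy), <- (f_ode z Hz). simpl. field. auto.
Qed.

Lemma f'_nz_at_pole p : to_inf f p -> near' p (fun y => f' y <> 0).
Proof.
  intros Hp.
  pose proof (proj1 (meromorphic_cases _ p f_mero)) as Hreg.
  pose proof (to_inf_inv _ _ Hp) as Hu.
  assert (K : clim (fun z => 4 - G2 * (/ f z * / f z) - G3 * (/ f z * (/ f z * / f z))) p
                (4 - G2 * (0 * 0) - G3 * (0 * (0 * 0)))).
  { repeat first [apply clim_minus | apply clim_mult | exact Hu | apply clim_const]. }
  assert (N : 4 - G2 * (0 * 0) - G3 * (0 * (0 * 0)) <> 0).
  { replace (4 - G2 * (0 * 0) - G3 * (0 * (0 * 0))) with (RtoC 4) by ring.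
    intros E. apply RtoC_inj in E. lra. }
  refine (near'_imp _ _ _ _ (near'_and _ _ _
    (near'_and _ _ _ Hreg (to_inf_neq _ _ 0 Hp)) (clim_neq _ _ _ _ K N))).
  intros z [[Hz Hz0] Hk] E. apply Hk.
  pose proof (f_ode z Hz) as O. rewrite E in O.
  transitivity (P (f z) * / f z ^ 3).
  - unfold cubic. simpl. field. exact Hz0.
  - rewrite <- O. simpl. ring.
Qed.

(** Around such a point |f'| is at most a multiple of |f - e|, where e is the value
    reached there, so f is the constant e. *)
Lemma no_double_root_reached q :
  Cderivable f q -> P (f q) = 0 -> dP (f q) = 0 -> near q (fun y => f' y = 0).
Proof.
  intros Hq E1 E2. set (e := f q) in *.
  pose proof (meromorphic_open _ _ f_mero Hq) as Hn.
  assert (HB : near q (fun y => (Cmod (4 * f y + 8 * e) < Cmod (4 * e + 8 * e) + 1)%R)).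
  { assert (Hc : clim (fun y => 4 * f y + 8 * e) q (4 * e + 8 * e)).
    { apply clim_plus; [|apply clim_const].
      apply clim_mult; [apply clim_const | now apply f_cont]. }
    apply near'_near; [|exact (clim_bounded _ _ _ Hc)]. fold e. lra. }
  set (K := (Cmod (4 * e + 8 * e) + 1)%R) in *.
  assert (K1 : (1 <= K)%R) by (unfold K; pose proof (Cmod_ge_0 (4 * e + 8 * e)); lra).
  destruct (near_and _ _ _ Hn HB) as [r [r0 Hr]].
  assert (Hfac : forall x, P x = (x - e) ^ 2 * (4 * x + 8 * e)).
  { intros x. transitivity (P x - P e - 2 * dP e * (x - e)).
    - rewrite E1, E2. ring.
    - unfold cubic, half_cubic'. simpl. field. }
  assert (Hz0 : (Cmod (q - q) < r)%R).
  { replace (q - q) with (RtoC 0) by ring. rewrite Cmod_0. exact r0. }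
  assert (Hconst : forall w, (Cmod (w - q) < r)%R -> f w = e).
  { intros w Hw.
    destruct (gronwall (fun y => f y - e) (fun _ => 0) (fun _ => 0)
                f' (fun _ => 0) (fun _ => 0) q w K) as [A _].
    - intros t Ht. cbv zeta. destruct (Hr _ (seg_ball _ _ _ _ _ Hz0 Hw Ht)) as [D B].
      set (z := seg q w t) in *. rewrite Cmod_0, !Rplus_0_r.
      pose proof (Cmod_ge_0 (f z - e)) as P0.
      assert (X : (0 <= K * Cmod (f z - e))%R) by (apply Rmult_le_pos; lra).
      repeat split; try apply cderive_const; try exact X.
      + refine (cderive_eq _ _ _ _ _
          (cderive_minus _ _ _ _ _ (derivable_cderive _ _ D) (cderive_const e z))). ring.
      + assert (S : (Cmod (f' z) ^ 2 <= (K * Cmod (f z - e)) ^ 2)%R).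
        { rewrite <- Cmod_pow, (f_ode z D), Hfac, Cmod_mult, Cmod_pow.
          rewrite Rpow_mult_distr, Rmult_comm.
          apply Rmult_le_compat_r; [apply pow2_ge_0 | nra]. }
        apply Rnot_lt_le. intros N. nra.
    - fold e. ring.
    - reflexivity.
    - reflexivity.
    - replace (f w) with (f w - e + e) by ring. rewrite A. ring. }
  assert (Hconst' : near q (fun w => f w = e)) by (exists r; auto).
  refine (near_imp _ _ _ _ (near_near _ _ Hconst')).
  intros w Hw. apply cderive_C_derive.
  apply (cderive_ext (fun _ => e)); [|apply cderive_const].
  apply near_imp with (2 := Hw). auto.
Qed.

(** The equation alone does not prevent f from being locally constant; its pole at 0
    does. Points p around which f' has no zero except perhaps p form an open set that
    contains 0. It is also closed: at a limit q of such points with f' q = 0, a double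
    root of the cubic would make f' vanish around q, and at a simple root f'' is nearly
    a nonzero constant off the zeros of f', so that a zero of f' close to q would be
    accompanied by a ball of zeros centred at q. *)
Lemma f'_zeros_isolated : forall p, near' p (fun y => Cderivable f y /\ f' y <> 0).
Proof.
  apply (clopen_plane _ 0).
  - apply near'_and; [now apply meromorphic_cases | now apply f'_nz_at_pole].
  - intros p Hp. apply near'_near; [exact Hp|].
    apply near'_imp with (2 := near'_near_near _ _ Hp). intros z. apply near_near'.
  - intros q Hq.
    apply near'_and; [now apply meromorphic_cases|].
    destruct (proj2 (meromorphic_cases _ q f_mero)) as [Dq|Iq];
      [|now apply f'_nz_at_pole].
    assert (Hacc : forall d, (0 < d)%R ->
              exists w, (Cmod (w - q) < d)%R /\ f' w <> 0).
    { intros d d0. destruct (Hq (d / 2)%R) as [p [Hp Hpq]]; [lra|].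
      destruct (near'_exists _ _ Hp (d / 2)%R) as [w [_ [Hw [_ Hw0]]]]; [lra|].
      exists w. split; [|exact Hw0].
      replace (w - q) with ((w - p) + (p - q)) by ring.
      eapply Rle_lt_trans; [apply Cmod_triangle | lra]. }
    destruct (classic (f' q = 0)) as [E|Hne].
    2: { apply (clim_neq _ _ (f' q)); [now apply f'_cont | exact Hne]. }
    assert (EP : P (f q) = 0) by (rewrite <- (f_ode q Dq), E; ring).
    set (c := dP (f q)).
    destruct (classic (c = 0)) as [Ec|Hc].
    { destruct (no_double_root_reached q Dq EP Ec) as [r [r0 Hr]].
      destruct (Hacc r r0) as [w [Hw Hw0]]. now elim Hw0; apply Hr. }
    pose proof (meromorphic_open _ _ f_mero Dq) as Hn.
    assert (c4 : (0 < Cmod c / 4)%R) by (apply Cmod_gt_0 in Hc; lra).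
    assert (Hq' : near q (fun y => (Cmod (dP (f y) - c) < Cmod c / 4)%R)).
    { apply (ccont_near (fun y => dP (f y))); [|exact c4].
      now apply dP_clim, f_cont. }
    destruct (near_and _ _ _ Hn Hq') as [r [r0 Hr]].
    exists r. split; [exact r0|]. intros z Hz Hzq Ez.
    assert (Hd : (0 < Cmod (z - q) / 10)%R).
    { apply Cminus_eq_contra in Hzq. apply Cmod_gt_0 in Hzq. lra. }
    destruct (Hacc _ Hd) as [w [Hw Hw0]]. apply Hw0.
    apply (two_zeros_fill_ball f' (fun y => dP (f y)) c q r) with (z := z); try assumption.
    + intros y Hy. now apply f'_cont, Hr.
    + intros y Hy Hy0. destruct (Hr y Hy) as [D B].
      split; [now apply f''_off_zeros | lra].
Qed.

(** At a zero z of f' the equation f'' = half_cubic' f holds all around z, and the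
    mean value inequality carries it to z. *)
Lemma f'' z : Cderivable f z -> cderive f' z (dP (f z)).
Proof.
  intros Hz. apply cderive_bound. intros eps e0.
  set (c := dP (f z)).
  assert (Hq : near z (fun y => (Cmod (dP (f y) - c) < eps)%R)).
  { apply (ccont_near (fun y => dP (f y))); [|exact e0]. now apply dP_clim, f_cont. }
  destruct (near_and _ _ _ (near_and _ _ _ (meromorphic_open _ _ f_mero Hz) Hq)
              (f'_zeros_isolated z)) as [r [r0 Hr]].
  exists r. split; [exact r0|]. intros y Hy.
  destruct (classic (y = z)) as [->|Hyz].
  { replace (f' z - f' z - c * (z - z)) with (RtoC 0) by ring.
    rewrite Cmod_0. apply Rmult_le_pos; [lra | apply Cmod_ge_0]. }
  assert (Hz0 : (Cmod (z - z) < r)%R).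
  { replace (z - z) with (RtoC 0) by ring. rewrite Cmod_0. exact r0. }
  replace (f' y - f' z - c * (y - z)) with ((f' y - c * y) - (f' z - c * z)) by ring.
  apply (mean_value (fun y => f' y - c * y) (fun y => dP (f y) - c)).
  - intros t Ht. destruct (Hr _ (seg_ball _ _ _ _ _ Hz0 Hy Ht)) as [[D _] _].
    apply clim_minus; [now apply f'_cont|].
    apply clim_mult; [apply clim_const | apply clim_id].
  - intros t Ht. assert (Ht' : (0 <= t <= 1)%R) by lra.
    destruct (Hr _ (seg_ball _ _ _ _ _ Hz0 Hy Ht')) as [[D B] N].
    split; [|lra].
    assert (Hne : seg z y t <> z).
    { intros E. apply Cminus_eq_contra in Hyz.
      assert (Et : t * (y - z) = 0).
      { transitivity (seg z y t - z); [unfold seg; ring | rewrite E; ring]. }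
      apply Cmult_neq_0 in Et; [easy| |exact Hyz].
      intros E0. apply RtoC_inj in E0. lra. }
    refine (cderive_eq _ _ _ _ _ (cderive_minus _ _ _ _ _ (f''_off_zeros _ D _)
      (cderive_mult _ _ _ _ _ (cderive_const c _) (cderive_id _)))).
    + ring.
    + now apply N.
Qed.

Lemma values_isolated k p : near' p (fun y => f y <> k).
Proof.
  destruct (proj2 (meromorphic_cases _ p f_mero)) as [D|I]; [|now apply to_inf_neq].
  destruct (classic (f p = k)) as [E|Hne].
  2: { apply (clim_neq _ _ (f p)); [now apply f_cont | exact Hne]. }
  destruct (classic (f' p = 0)) as [E'|Hne].
  - assert (EP : P k = 0) by (rewrite <- E, <- (f_ode p D), E'; ring).
    apply near'_imp with (2 := f'_zeros_isolated p). intros y [Dy Ny] Ey.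
    apply Ny. apply NNPP. intros N. apply (Cpow_nz _ 2) in N. apply N.
    now rewrite (f_ode y Dy), Ey.
  - pose proof (derivable_cderive _ _ D) as H.
    apply near'_imp with (2 := clim_neq _ _ _ _ H Hne).
    intros y N Ey. apply N. rewrite Ey, E. unfold Cdiv. ring.
Qed.

(** * The zeta function *)

Variable zeta : C -> C.
Hypothesis z_mero : meromorphic zeta.
Hypothesis z_odd : forall z, Cderivable zeta z -> zeta (- z) = - zeta z.
Hypothesis z_der : forall z, Cderivable zeta z -> C_derive zeta z = - f z.

Lemma zeta_cderive z : Cderivable zeta z -> cderive zeta z (- f z).
Proof. intros H. rewrite <- (z_der z H). now apply derivable_cderive. Qed.

(** The derivative of zeta is bounded around z, hence so is zeta, which then cannot
    have a pole there. *)
Lemma zeta_regular z : Cderivable f z -> Cderivable zeta z.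
Proof.
  intros Hz. destruct (meromorphic_cases _ z z_mero) as [Hn [D|I]]; [exact D|].
  exfalso.
  pose proof (clim_bounded _ _ _ (f_cont _ Hz)) as HB.
  set (K := (Cmod (f z) + 1)%R) in HB.
  destruct (near'_and _ _ _ Hn HB) as [r [r0 Hr]].
  destruct (near'_exists _ _ Hn r r0) as [a [Ha [Har _]]].
  destruct (near'_exists _ _ (I (Cmod (zeta a) + 4 * K * r)%R) r r0)
    as [b [Hb [Hbr Hbig]]].
  assert (V : (Cmod (zeta b - zeta a) <= 4 * K * r)%R).
  { apply (punctured_variation zeta (fun y => - f y) z r K); try assumption.
    intros y Hy Hyr. destruct (Hr y Hyr Hy) as [D B]. split.
    - now apply zeta_cderive.
    - rewrite Cmod_opp. lra. }
  assert (Cmod (zeta b) <= Cmod (zeta b - zeta a) + Cmod (zeta a))%R; [|lra].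
  replace (zeta b) with ((zeta b - zeta a) + zeta a) at 1 by ring.
  apply Cmod_triangle.
Qed.

Let Psi (x : C) : C := zeta x + f' x / (2 * f x).

(** At a pole of f the leading terms cancel in the derivative of zeta + f'/(2 f), which
    is G2 / (4 f) + G3 / (2 f^2) and tends to 0. *)
Lemma Psi_variation p : to_inf f p ->
  exists r, (0 < r)%R /\
    (forall y, y <> p -> (Cmod (y - p) < r)%R ->
       Cderivable f y /\ Cderivable zeta y /\ f y <> 0) /\
    forall rho a b, (rho <= r)%R -> a <> p -> b <> p ->
      (Cmod (a - p) < rho)%R -> (Cmod (b - p) < rho)%R ->
      (Cmod (Psi b - Psi a) <= 4 * rho)%R.
Proof.
  intros Hp.
  set (D := fun y => G2 / 4 * / f y + G3 / 2 * (/ f y * / f y)).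
  assert (HD : clim D p 0).
  { apply (clim_eq _ _ (G2 / 4 * 0 + G3 / 2 * (0 * 0))); [ring|].
    pose proof (to_inf_inv _ _ Hp) as Hu. unfold D.
    repeat first [apply clim_plus | apply clim_mult | exact Hu | apply clim_const]. }
  assert (D1 : near' p (fun y => (Cmod (D y) < 1)%R)).
  { refine (near'_imp _ _ _ _ (HD 1%R Rlt_0_1)). intros y Hy.
    now replace (D y - 0) with (D y) in Hy by ring. }
  destruct (near'_and _ _ _
    (near'_and _ _ _ (proj1 (meromorphic_cases _ p f_mero)) (to_inf_neq _ _ 0 Hp)) D1)
    as [r [r0 Hr]].
  exists r. split; [exact r0|]. split.
  - intros y Hy Hyr. destruct (Hr y Hyr Hy) as [[Dy Ny] _].
    split; [exact Dy|]. split; [now apply zeta_regular | exact Ny].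
  - intros rho a b Hrho Ha Hb Har Hbr. rewrite <- (Rmult_1_r 4).
    apply (punctured_variation Psi D p); try assumption.
    intros y Hy Hyr. destruct (Hr y (Rlt_le_trans _ _ _ Hyr Hrho) Hy) as [[Dy Ny] By].
    split; [|lra].
    assert (N2 : 2 * f y <> 0).
    { apply Cmult_neq_0; [|exact Ny]. intros E. apply RtoC_inj in E. lra. }
    refine (cderive_eq _ _ _ _ _ (cderive_plus _ _ _ _ _ (zeta_cderive _ (zeta_regular _ Dy))
      (cderive_div f' (fun x => 2 * f x) y _ _ N2 (f'' _ Dy)
        (cderive_mult _ _ _ _ _ (cderive_const 2 y) (derivable_cderive _ _ Dy))))).
    pose proof (f_ode y Dy) as O.
    transitivity ((dP (f y) * (2 * f y) - 2 * f' y ^ 2) / (2 * f y * (2 * f y)) - f y).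
    + simpl. field. exact Ny.
    + rewrite O. unfold D, half_cubic', cubic. simpl. field. exact Ny.
Qed.

(** Were zeta regular at a pole of f, the quotient f'/f would be bounded there, and
    f would grow at most exponentially along segments towards the pole. *)
Lemma zeta_singular p : Cderivable zeta p -> Cderivable f p.
Proof.
  intros Hz. destruct (proj2 (meromorphic_cases _ p f_mero)) as [D|I]; [exact D|].
  exfalso. destruct (Psi_variation p I) as [r [r0 [Hreg Hvar]]].
  destruct (clim_bounded _ _ _ (cderive_cont _ _ _ (derivable_cderive _ _ Hz)))
    as [r' [r0' Hzb]].
  set (rho := Rmin r r').
  assert (rho0 : (0 < rho)%R) by now apply Rmin_glb_lt.
  assert (Hr1 : (rho <= r)%R) by apply Rmin_l.
  assert (Hr2 : (rho <= r')%R) by apply Rmin_r.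
  destruct (near'_exists p (fun _ => True)) with (d := rho) as [a [Ha [Har _]]];
    [now apply near_all | exact rho0 |].
  set (B := (Cmod (zeta p) + 1)%R) in *.
  set (K := (2 * (4 * rho + Cmod (Psi a) + B))%R).
  assert (HK : forall y, y <> p -> (Cmod (y - p) < rho)%R ->
            (Cmod (f' y) <= K * Cmod (f y))%R).
  { intros y Hy Hyr.
    destruct (Hreg y Hy (Rlt_le_trans _ _ _ Hyr Hr1)) as [_ [_ Ny]].
    pose proof (Hvar rho a y Hr1 Ha Hy Har Hyr) as V.
    pose proof (Hzb y (Rlt_le_trans _ _ _ Hyr Hr2) Hy) as Z.
    replace (f' y) with (2 * f y * (Psi y - zeta y))
      by (unfold Psi; field; exact Ny).
    replace (Psi y - zeta y) with ((Psi y - Psi a) + (Psi a - zeta y)) by ring.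
    rewrite !Cmod_mult, Cmod_R, Rabs_pos_eq by lra.
    assert (Cmod (Psi y - Psi a + (Psi a - zeta y)) <= 4 * rho + Cmod (Psi a) + B)%R.
    { eapply Rle_trans; [apply Cmod_triangle|].
      assert (Cmod (Psi a - zeta y) <= Cmod (Psi a) + Cmod (zeta y))%R; [|lra].
      replace (Psi a - zeta y) with (Psi a + - zeta y) by ring.
      eapply Rle_trans; [apply Cmod_triangle | rewrite Cmod_opp; lra]. }
    unfold K. pose proof (Cmod_ge_0 (f y)). nra. }
  set (A := (Cmod (f a) ^ 2 * exp (2 * K * Cmod (p - a)))%R).
  destruct (I (A + 1)%R) as [d [d0 Hd]].
  assert (La : (0 < Cmod (p - a))%R).
  { apply Cmod_gt_0, Cminus_eq_contra. auto. }
  set (t := (Rmin (/ 2) (d / (2 * Cmod (p - a))))%R).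
  assert (t0 : (0 < t)%R).
  { apply Rmin_glb_lt; [lra|]. apply Rdiv_lt_0_compat; lra. }
  assert (t1 : (t <= / 2)%R) by apply Rmin_l.
  assert (t2 : (t * Cmod (p - a) < d)%R).
  { apply Rle_lt_trans with (d / (2 * Cmod (p - a)) * Cmod (p - a))%R.
    - apply Rmult_le_compat_r; [lra | apply Rmin_r].
    - replace (d / (2 * Cmod (p - a)) * Cmod (p - a))%R with (d / 2)%R; [lra|].
      field. lra. }
  set (b := seg a p (1 - t)).
  assert (Ebp : b - p = RtoC (- t) * (p - a)).
  { unfold b, seg. rewrite RtoC_minus, RtoC_opp. ring. }
  assert (Hseg : forall s, (0 <= s <= 1)%R -> exists u, (t <= u <= 1)%R /\
             seg a b s - p = RtoC (- u) * (p - a)).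
  { intros s Hs. exists (1 - s * (1 - t))%R. split; [nra|].
    unfold b, seg. rewrite !RtoC_opp, !RtoC_minus, RtoC_mult, RtoC_minus. ring. }
  assert (Hb : (Cmod (f b) ^ 2 <= Cmod (f a) ^ 2 * exp (2 * K * Cmod (b - a)))%R).
  { apply (growth_on_seg f f'). intros s Hs. cbv zeta.
    destruct (Hseg s Hs) as [u [Hu Eu]].
    assert (Hne : seg a b s <> p).
    { intros E. rewrite E in Eu.
      assert (Cmod (RtoC (- u) * (p - a)) = 0%R).
      { rewrite <- Eu. replace (p - p) with (RtoC 0) by ring. apply Cmod_0. }
      rewrite Cmod_mult, Cmod_R, Rabs_Ropp, Rabs_pos_eq in H by lra. nra. }
    assert (Hin : (Cmod (seg a b s - p) < rho)%R).
    { rewrite Eu, Cmod_mult, Cmod_R, Rabs_Ropp, Rabs_pos_eq by lra.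
      replace (p - a) with (- (a - p)) in * by ring. rewrite Cmod_opp in *. nra. }
    split; [|now apply HK].
    apply derivable_cderive. now apply (Hreg _ Hne (Rlt_le_trans _ _ _ Hin Hr1)). }
  assert (Hbig : (A + 1 < Cmod (f b))%R).
  { apply Hd.
    - rewrite Ebp, Cmod_mult, Cmod_R, Rabs_Ropp, Rabs_pos_eq; lra.
    - intros E. rewrite E in Ebp.
      assert (Cmod (RtoC (- t) * (p - a)) = 0%R).
      { rewrite <- Ebp. replace (p - p) with (RtoC 0) by ring. apply Cmod_0. }
      rewrite Cmod_mult, Cmod_R, Rabs_Ropp, Rabs_pos_eq in H by lra. nra. }
  assert (HA : (Cmod (f b) ^ 2 <= A)%R).
  { eapply Rle_trans; [exact Hb|]. unfold A.
    apply Rmult_le_compat_l; [apply pow2_ge_0|].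
    assert (Eba : (Cmod (b - a) = (1 - t) * Cmod (p - a))%R).
    { replace (b - a) with (RtoC (1 - t) * (p - a)) by (unfold b, seg; ring).
      rewrite Cmod_mult, Cmod_R, Rabs_pos_eq by lra. reflexivity. }
    assert (K0 : (0 <= K)%R).
    { unfold K, B. pose proof (Cmod_ge_0 (Psi a)). pose proof (Cmod_ge_0 (zeta p)). lra. }
    assert (Hle : (2 * K * Cmod (b - a) <= 2 * K * Cmod (p - a))%R).
    { apply Rmult_le_compat_l; [lra | rewrite Eba; nra]. }
    destruct Hle as [Hlt|E]; [left; now apply exp_increasing | right; now rewrite E]. }
  assert (0 <= A)%R by (eapply Rle_trans; [apply pow2_ge_0 | exact HA]).
  nra.
Qed.

(** Differentiate the oddness of zeta. *)
Lemma f_even z : Cderivable f z -> Cderivable f (- z) /\ f (- z) = f z.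
Proof.
  intros Hz. pose proof (zeta_regular z Hz) as Dz.
  destruct (meromorphic_open _ _ z_mero Dz) as [r [r0 Hr]].
  assert (H : cderive zeta (- z) (- f z)).
  { apply (cderive_ext (fun x => - zeta (- x))).
    - exists r. split; [exact r0|]. intros x Hx.
      assert (E : zeta (- - x) = - zeta (- x)).
      { apply z_odd, Hr. replace (- x - z) with (- (x - - z)) by ring.
        now rewrite Cmod_opp. }
      rewrite <- E. f_equal. ring.
    - apply (cderive_eq _ _ (- - - f z)); [ring|]. apply cderive_opp, cderive_reflect.
      replace (- - z) with z by ring. now apply zeta_cderive. }
  pose proof (cderive_derivable _ _ _ H) as D. split.
  - now apply zeta_singular.
  - pose proof (z_der _ D) as E. rewrite (cderive_C_derive _ _ _ H) in E.
    replace (f z) with (- - f z) by ring. rewrite E. ring.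
Qed.

Lemma f'_odd z : Cderivable f z -> f' (- z) = - f' z.
Proof.
  intros Hz. apply cderive_C_derive.
  destruct (meromorphic_open _ _ f_mero Hz) as [r [r0 Hr]].
  apply (cderive_ext (fun x => f (- x))).
  - exists r. split; [exact r0|]. intros x Hx.
    destruct (f_even (- x)) as [_ E].
    { apply Hr. replace (- x - z) with (- (x - - z)) by ring. now rewrite Cmod_opp. }
    rewrite <- E. f_equal. ring.
  - apply cderive_reflect. replace (- - z) with z by ring. now apply derivable_cderive.
Qed.

(** Psi is odd and varies little around 0, so Psi x and - Psi x are close. *)
Lemma Psi_0 : clim Psi 0 0.
Proof.
  intros eps e0. destruct (Psi_variation 0 f_pole) as [r [r0 [Hreg Hvar]]].
  set (rho := (Rmin r (eps / 3))%R).
  assert (rho0 : (0 < rho)%R) by (apply Rmin_glb_lt; lra).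
  assert (Hr1 : (rho <= r)%R) by apply Rmin_l.
  assert (Hr2 : (rho <= eps / 3)%R) by apply Rmin_r.
  exists rho. split; [exact rho0|]. intros x Hx Hx0.
  destruct (Hreg x Hx0 (Rlt_le_trans _ _ _ Hx Hr1)) as [D [Dz N]].
  assert (Hodd : Psi (- x) = - Psi x).
  { unfold Psi. destruct (f_even x D) as [_ E].
    rewrite E, (f'_odd x D), (z_odd x Dz). field. exact N. }
  assert (Hnx : - x <> 0).
  { intros E. apply Hx0. replace x with (- - x) by ring. rewrite E. ring. }
  assert (Hx' : (Cmod (- x - 0) < rho)%R).
  { replace (- x - 0) with (- (x - 0)) by ring. now rewrite Cmod_opp. }
  pose proof (Hvar rho (- x) x Hr1 Hnx Hx0 Hx' Hx) as V. rewrite Hodd in V.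
  replace (Psi x - - Psi x) with (2 * (Psi x - 0)) in V by ring.
  rewrite Cmod_mult, Cmod_R, Rabs_pos_eq in V by lra. lra.
Qed.

(** * The addition theorem *)

Lemma f'_over_f2 p : to_inf f p -> clim (fun x => f' x * (/ f x * / f x)) p 0.
Proof.
  intros Hp.
  pose proof (to_inf_inv _ _ Hp) as Hu.
  apply clim_sqr_0.
  apply (clim_ext (fun x => 4 * / f x - G2 * (/ f x * (/ f x * / f x))
                            - G3 * (/ f x * / f x * (/ f x * / f x)))).
  - refine (near'_imp _ _ _ _ (near'_and _ _ _
      (proj1 (meromorphic_cases _ p f_mero)) (to_inf_neq _ _ 0 Hp))).
    intros x [D N].
    transitivity (P (f x) * / f x ^ 4); [unfold cubic; simpl; field; exact N|].
    rewrite <- (f_ode x D). simpl. field. exact N.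
  - apply (clim_eq _ _ (4 * 0 - G2 * (0 * (0 * 0)) - G3 * (0 * 0 * (0 * 0)))); [ring|].
    repeat first [apply clim_minus | apply clim_mult | exact Hu | apply clim_const].
Qed.

(** Around a pole of f the chords from (f, f') to points that stay bounded are
    well defined. *)
Lemma pole_neq p c e : to_inf f p -> clim c p e ->
  near' p (fun x => f x <> 0 /\ f x <> c x).
Proof.
  intros Hp Hc.
  assert (H1 : clim (fun x => 1 - c x * / f x) p (1 - e * 0)).
  { pose proof (to_inf_inv _ _ Hp) as Hu.
    repeat first [apply clim_minus | apply clim_mult | exact Hu | exact Hc
                 | apply clim_const]. }
  assert (N1 : 1 - e * 0 <> 0).
  { replace (1 - e * 0) with (RtoC 1) by ring. intros X; apply RtoC_inj in X; lra. }
  refine (near'_imp _ _ _ _ (near'_and _ _ _ (to_inf_neq _ _ 0 Hp)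
                               (clim_neq _ _ _ _ H1 N1))).
  intros x [A B]. split; [exact A|]. intros X. apply B. rewrite <- X. field. exact A.
Qed.

(** For (c, - c') on the curve the expression is the abscissa of the third intersection
    of the curve with the chord from (f, f') to (c, - c'), and the chord becomes vertical
    as (f, f') goes to infinity. In the expanded numerator the terms in f^3 cancel, and
    f' / f^2 tends to 0, so that dividing by f^2 gives the limit. *)
Lemma chord_limit p c c' e eta :
  to_inf f p -> clim c p e -> clim c' p eta ->
  clim (fun x => ((f' x + c' x) / (2 * (f x - c x))) ^ 2 - f x - c x) p e.
Proof.
  intros Hp Hc Hc'.
  pose proof (to_inf_inv _ _ Hp) as Hu.
  pose proof (f'_over_f2 _ Hp) as Hq.
  assert (N4 : 4 * ((1 - e * 0) * (1 - e * 0)) <> 0).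
  { replace (4 * ((1 - e * 0) * (1 - e * 0))) with (RtoC 4) by ring.
    intros X; apply RtoC_inj in X; lra. }
  set (D := fun x => 4 * ((1 - c x * / f x) * (1 - c x * / f x))).
  assert (H1 : clim D p (4 * ((1 - e * 0) * (1 - e * 0)))).
  { unfold D. repeat first [apply clim_const | apply clim_minus | apply clim_mult
                 | exact Hu | exact Hc]. }
  apply (clim_ext (fun x =>
    (8 * c x + 2 * c' x * (f' x * (/ f x * / f x)) - (G2 + 4 * (c x * c x)) * / f x
      + (c' x * c' x - G3) * (/ f x * / f x)) * / D x - c x)).
  - refine (near'_imp _ _ _ _ (near'_and _ _ _ (pole_neq _ _ _ Hp Hc)
              (proj1 (meromorphic_cases _ p f_mero)))).
    intros x [[A B] R]. apply Cminus_eq_contra in B.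
    assert (B' : f x ^ 2 - 2 * f x * c x + c x ^ 2 <> 0).
    { replace (f x ^ 2 - 2 * f x * c x + c x ^ 2) with ((f x - c x) ^ 2) by ring.
      now apply Cpow_nz. }
    transitivity ((P (f x) + 2 * f' x * c' x + c' x ^ 2) / (4 * (f x - c x) ^ 2)
                  - f x - c x).
    + unfold D, cubic. simpl. field. auto.
    + rewrite <- (f_ode x R). simpl. field. exact B.
  - apply (clim_eq _ _
      ((8 * e + 2 * eta * 0 - (G2 + 4 * (e * e)) * 0
        + (eta * eta - G3) * (0 * 0))
       * / (4 * ((1 - e * 0) * (1 - e * 0))) - e)).
    { field. }
    repeat first [ apply clim_const | exact N4 | exact H1 | exact Hu | exact Hc
                 | exact Hc' | exact Hq | apply clim_inv | apply clim_minus
                 | apply clim_plus | apply clim_mult ].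
Qed.

(** Write c for the translate of f by s. The addition theorem says that the points
    (f, f'), (c, - c') and (f s, - f' s) lie on a line of slope 2 F. The line of
    slope 2 F through (f, f') contains (c, - c') exactly when M vanishes; E and T compare
    the coefficients of X^2 and X in cubic X - (2 F (X - f) + f')^2 with those of
    4 (X - f) (X - c) (X - f s). Together E, M and T satisfy a homogeneous linear
    differential system whose coefficients are finite wherever f and c are, even at
    points where f = c and the chord becomes a tangent. It therefore suffices that
    they vanish around 0. *)
Section Addition.

Variable s : C.
Hypothesis s_reg : Cderivable f s.

Let c (x : C) : C := f (x - s).
Let c' (x : C) : C := f' (x - s).
Let F (x : C) : C := zeta s + zeta (x - s) - zeta x.
Let E (x : C) : C := F x ^ 2 - f x - c x - f s.
Let M (x : C) : C := 2 * F x * (f x - c x) - f' x - c' x.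
Let T (x : C) : C := G2 + 4 * F x * (f' x - 2 * F x * f x)
                     + 4 * (f x * c x + f x * f s + c x * f s).
Let reg2 (x : C) : Prop := Cderivable f x /\ Cderivable f (x - s).

Lemma reg2_near' p : near' p reg2.
Proof.
  apply near'_and; [now apply meromorphic_cases|].
  apply near'_translate. now apply meromorphic_cases.
Qed.

Lemma c_cderive x : reg2 x -> cderive c x (c' x).
Proof. intros [_ D]. apply cderive_translate. now apply derivable_cderive. Qed.

Lemma c'_cderive x : reg2 x -> cderive c' x (dP (c x)).
Proof. intros [_ D]. apply cderive_translate. now apply f''. Qed.

Lemma F_cderive x : reg2 x -> cderive F x (f x - c x).
Proof.
  intros [D1 D2].
  refine (cderive_eq _ _ _ _ _ (cderive_minus _ _ _ _ _
    (cderive_plus _ _ _ _ _ (cderive_const (zeta s) x)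
       (cderive_translate _ _ _ _ (zeta_cderive _ (zeta_regular _ D2))))
    (zeta_cderive _ (zeta_regular _ D1)))).
  unfold c. ring.
Qed.

Lemma E_cderive x : reg2 x -> cderive E x (M x).
Proof.
  intros R. pose proof (F_cderive x R) as DF.
  refine (cderive_eq _ _ _ _ _ (cderive_ext _ _ _ _ _ (cderive_minus _ _ _ _ _
    (cderive_minus _ _ _ _ _ (cderive_minus _ _ _ _ _ (cderive_mult _ _ _ _ _ DF DF)
       (derivable_cderive _ _ (proj1 R))) (c_cderive x R)) (cderive_const (f s) x)))).
  - unfold M. ring.
  - apply near_all. intros y. unfold E. simpl. ring.
Qed.

Lemma M_cderive x : reg2 x -> cderive M x (T x + 4 * (f x + c x) * E x + 2 * F x * M x).
Proof.
  intros R. pose proof (F_cderive x R) as DF. pose proof (c_cderive x R) as Dc.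
  pose proof (derivable_cderive _ _ (proj1 R)) as Df.
  refine (cderive_eq _ _ _ _ _ (cderive_minus _ _ _ _ _ (cderive_minus _ _ _ _ _
    (cderive_mult _ _ _ _ _ (cderive_mult _ _ _ _ _ (cderive_const 2 x) DF)
       (cderive_minus _ _ _ _ _ Df Dc)) (f'' x (proj1 R))) (c'_cderive x R))).
  unfold E, M, T, half_cubic'. simpl. field.
Qed.

Lemma T_cderive x : reg2 x ->
  cderive T x (- (2 * F x) * T x - 16 * F x * f x * E x - 4 * (f x + f s) * M x).
Proof.
  intros R. pose proof (F_cderive x R) as DF. pose proof (c_cderive x R) as Dc.
  pose proof (derivable_cderive _ _ (proj1 R)) as Df.
  pose proof (cderive_const (f s) x) as De.
  refine (cderive_eq _ _ _ _ _ (cderive_plus _ _ _ _ _ (cderive_plus _ _ _ _ _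
    (cderive_const G2 x)
    (cderive_mult _ _ _ _ _ (cderive_mult _ _ _ _ _ (cderive_const 4 x) DF)
      (cderive_minus _ _ _ _ _ (f'' x (proj1 R))
        (cderive_mult _ _ _ _ _ (cderive_mult _ _ _ _ _ (cderive_const 2 x) DF) Df))))
    (cderive_mult _ _ _ _ _ (cderive_const 4 x)
      (cderive_plus _ _ _ _ _ (cderive_plus _ _ _ _ _ (cderive_mult _ _ _ _ _ Df Dc)
        (cderive_mult _ _ _ _ _ Df De)) (cderive_mult _ _ _ _ _ Dc De))))).
  unfold E, M, T, half_cubic'. simpl. field.
Qed.

(** Around 0 the function f dominates c, and F - (f' + c') / (2 (f - c)) has
    derivative 0. Its limit at 0 is 0, since up to terms that tend to 0 it is
    zeta s + zeta (- s) - Psi. *)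
Lemma M_near_0 : near' 0 (fun x => M x = 0).
Proof.
  destruct (f_even s s_reg) as [Ds Es].
  assert (E0s : 0 - s = - s) by ring.
  assert (Hc : clim c 0 (f s)).
  { apply (clim_translate f 0 s). rewrite E0s, <- Es. now apply f_cont. }
  assert (Hc' : clim c' 0 (f' (- s))).
  { apply (clim_translate f' 0 s). rewrite E0s. now apply f'_cont. }
  pose proof (to_inf_inv _ _ f_pole) as Hu.
  pose proof (f'_over_f2 _ f_pole) as Hq.
  assert (H1 : clim (fun x => 1 - c x * / f x) 0 1).
  { apply (clim_eq _ _ (1 - f s * 0)); [ring|].
    repeat first [apply clim_minus | apply clim_mult | exact Hu | exact Hc
                 | apply clim_const]. }
  assert (N1 : RtoC 1 <> 0) by (intros X; apply RtoC_inj in X; lra).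
  assert (Hreg : near' 0 (fun x => reg2 x /\ f x <> 0 /\ f x <> c x)).
  { apply near'_and; [apply reg2_near' | exact (pole_neq _ _ _ f_pole Hc)]. }
  set (Phi := fun x => F x - (f' x + c' x) / (2 * (f x - c x))).
  assert (HPhi : forall x, reg2 x -> f x <> c x -> cderive Phi x 0).
  { intros x R N.
    assert (N2 : 2 * (f x - c x) <> 0).
    { apply Cmult_neq_0; [|now apply Cminus_eq_contra].
      intros X; apply RtoC_inj in X; lra. }
    refine (cderive_eq _ _ _ _ _ (cderive_minus _ _ _ _ _ (F_cderive x R)
      (cderive_div (fun x => f' x + c' x) (fun x => 2 * (f x - c x)) x _ _ N2
        (cderive_plus _ _ _ _ _ (f'' x (proj1 R)) (c'_cderive x R))
        (cderive_mult _ _ _ _ _ (cderive_const 2 x)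
          (cderive_minus _ _ _ _ _ (derivable_cderive _ _ (proj1 R)) (c_cderive x R)))))).
    apply Cminus_eq_contra in N. cbv beta.
    transitivity (f x - c x - ((dP (f x) + dP (c x)) * (f x - c x)
                    - (f' x ^ 2 - c' x ^ 2)) / (2 * (f x - c x) ^ 2)).
    { simpl. field. exact N. }
    unfold c' at 1. rewrite (f_ode x (proj1 R)), (f_ode (x - s) (proj2 R)).
    fold (c x). unfold half_cubic', cubic. simpl. field. exact N. }
  assert (LPhi : clim Phi 0 0).
  { apply (clim_ext (fun x => zeta s + zeta (x - s) - Psi x
       + / 2 * - ((c x * (f' x * (/ f x * / f x)) + c' x * / f x)
                  * / (1 - c x * / f x)))).
    - apply near'_imp with (2 := Hreg). intros x [R [A B]].
      apply Cminus_eq_contra in B.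
      unfold Phi, Psi, F. field. auto.
    - apply (clim_eq _ _ (zeta s + zeta (- s) - 0
         + / 2 * - ((f s * 0 + f' (- s) * 0) * / 1))).
      { rewrite (z_odd _ (zeta_regular _ s_reg)). field. }
      pose proof Psi_0 as HPsi.
      assert (Hz : clim (fun x => zeta (x - s)) 0 (zeta (- s))).
      { apply (clim_translate zeta 0 s). rewrite E0s.
        exact (cderive_cont _ _ _ (zeta_cderive _ (zeta_regular _ Ds))). }
      repeat first [ apply clim_const | apply clim_plus | apply clim_minus
                   | apply clim_opp | apply clim_mult | apply clim_inv
                   | exact Hu | exact Hc | exact Hc' | exact Hq | exact HPsi
                   | exact Hz | exact H1 | exact N1 ]. }
  assert (Z : near' 0 (fun x => Phi x = 0)).
  { apply zero_near_limit; [|exact LPhi]. apply near'_imp with (2 := Hreg).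
    intros x [R [_ B]]. now apply HPhi. }
  refine (near'_imp _ _ _ _ (near'_and _ _ _ Hreg Z)).
  intros x [[_ [_ B]] Zx]. apply Cminus_eq_contra in B.
  transitivity (2 * (f x - c x) * Phi x).
  - unfold M, Phi. field. exact B.
  - rewrite Zx. ring.
Qed.

(** Since M vanishes E is locally constant, and its limit at 0 is found by replacing F
    by half the slope of the chord. *)
Lemma E_near_0 : near' 0 (fun x => E x = 0).
Proof.
  destruct (f_even s s_reg) as [Ds Es].
  assert (E0s : 0 - s = - s) by ring.
  assert (Hc : clim c 0 (f s)).
  { apply (clim_translate f 0 s). rewrite E0s, <- Es. now apply f_cont. }
  assert (Hc' : clim c' 0 (f' (- s))).
  { apply (clim_translate f' 0 s). rewrite E0s. now apply f'_cont. }
  assert (Hreg : near' 0 (fun x => (reg2 x /\ f x <> 0 /\ f x <> c x) /\ M x = 0)).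
  { apply near'_and; [|exact M_near_0].
    apply near'_and; [apply reg2_near' | exact (pole_neq _ _ _ f_pole Hc)]. }
  assert (LE : clim E 0 0).
  { apply (clim_ext (fun x =>
      ((f' x + c' x) / (2 * (f x - c x))) ^ 2 - f x - c x - f s)).
    - apply near'_imp with (2 := Hreg). intros x [[R [A B]] HM].
      apply Cminus_eq_contra in B.
      replace ((f' x + c' x) / (2 * (f x - c x))) with (F x); [reflexivity|].
      transitivity ((M x + f' x + c' x) / (2 * (f x - c x))).
      + unfold M. field. exact B.
      + rewrite HM. field. exact B.
    - apply (clim_eq _ _ (f s - f s)); [ring|].
      apply clim_minus; [exact (chord_limit _ _ _ _ _ f_pole Hc Hc') | apply clim_const]. }
  apply zero_near_limit; [|exact LE]. apply near'_imp with (2 := Hreg).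
  intros x [[R _] HM]. rewrite <- HM. now apply E_cderive.
Qed.

Lemma EMT_near_0 : near' 0 (fun x => reg2 x /\ E x = 0 /\ M x = 0 /\ T x = 0).
Proof.
  refine (near'_imp _ _ _ _ (near'_and _ _ _ (near'_and _ _ _ (reg2_near' 0) E_near_0)
            (near'_near_near _ _ M_near_0))).
  intros x [[R HE] HM]. pose proof (near_at _ _ HM) as HM0. cbv beta in HM0.
  repeat split; try assumption; try apply R.
  assert (Z : cderive M x 0).
  { apply (cderive_ext (fun _ => 0)); [|apply cderive_const].
    apply near_imp with (2 := HM). auto. }
  pose proof (clim_unique _ _ _ _ Z (M_cderive x R)) as K.
  rewrite HE, HM0 in K.
  transitivity (T x + 4 * (f x + c x) * 0 + 2 * F x * 0); [ring | now rewrite <- K].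
Qed.

Lemma EMT_along a b :
  (forall t, (0 <= t <= 1)%R -> reg2 (seg a b t)) ->
  E a = 0 /\ M a = 0 /\ T a = 0 -> E b = 0 /\ M b = 0 /\ T b = 0.
Proof.
  intros R [Ea [Ma Ta]].
  assert (HF : forall t, (0 <= t <= 1)%R -> ccont F (seg a b t)).
  { intros t Ht. exact (cderive_cont _ _ _ (F_cderive _ (R t Ht))). }
  assert (Hf : forall t, (0 <= t <= 1)%R -> ccont f (seg a b t)).
  { intros t Ht. exact (f_cont _ (proj1 (R t Ht))). }
  assert (Hc : forall t, (0 <= t <= 1)%R -> ccont c (seg a b t)).
  { intros t Ht. exact (cderive_cont _ _ _ (c_cderive _ (R t Ht))). }
  destruct (bounded_on_seg (fun x => 4 * (f x + c x)) a b) as [K1 H1].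
  { intros t Ht. apply clim_mult; [apply clim_const|].
    apply clim_plus; [now apply Hf | now apply Hc]. }
  destruct (bounded_on_seg (fun x => 2 * F x) a b) as [K2 H2].
  { intros t Ht. apply clim_mult; [apply clim_const | now apply HF]. }
  destruct (bounded_on_seg (fun x => 16 * F x * f x) a b) as [K3 H3].
  { intros t Ht. apply clim_mult; [|now apply Hf].
    apply (clim_mult (fun _ => RtoC 16)); [apply clim_const | now apply HF]. }
  destruct (bounded_on_seg (fun x => 4 * (f x + f s)) a b) as [K4 H4].
  { intros t Ht. apply clim_mult; [apply clim_const|].
    apply clim_plus; [now apply Hf | apply clim_const]. }
  apply (gronwall E M T M (fun x => T x + 4 * (f x + c x) * E x + 2 * F x * M x)
    (fun x => - (2 * F x) * T x - 16 * F x * f x * E x - 4 * (f x + f s) * M x)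
    a b (1 + K1 + K2 + K3 + K4)%R); try assumption.
  intros t Ht z S. specialize (H1 t Ht). specialize (H2 t Ht).
  specialize (H3 t Ht). specialize (H4 t Ht). fold z in H1, H2, H3, H4.
  pose proof (Cmod_ge_0 (4 * (f z + c z))) as P1.
  pose proof (Cmod_ge_0 (2 * F z)) as P2.
  pose proof (Cmod_ge_0 (16 * F z * f z)) as P3.
  pose proof (Cmod_ge_0 (4 * (f z + f s))) as P4.
  pose proof (Cmod_ge_0 (E z)) as PE. pose proof (Cmod_ge_0 (M z)) as PM.
  pose proof (Cmod_ge_0 (T z)) as PT.
  assert (X : forall k K u, (Cmod k <= K)%R -> (Cmod (k * u) <= K * Cmod u)%R).
  { intros k K u Hk. rewrite Cmod_mult.
    apply Rmult_le_compat_r; [apply Cmod_ge_0 | exact Hk]. }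
  assert (Q1 : (0 <= K1)%R) by lra. assert (Q2 : (0 <= K2)%R) by lra.
  assert (Q3 : (0 <= K3)%R) by lra. assert (Q4 : (0 <= K4)%R) by lra.
  split; [|split]; (split; [first [now apply E_cderive, R | now apply M_cderive, R
                                  | now apply T_cderive, R]|]).
  - unfold S. nra.
  - eapply Rle_trans; [apply Cmod_triangle|].
    pose proof (Cmod_triangle (T z) (4 * (f z + c z) * E z)).
    pose proof (X _ _ (E z) H1). pose proof (X _ _ (M z) H2). unfold S. nra.
  - unfold Cminus. eapply Rle_trans; [apply Cmod_triangle|].
    pose proof (Cmod_triangle (- (2 * F z) * T z) (- (16 * F z * f z * E z))) as Y.
    rewrite Cmod_opp in Y |- *.
    replace (- (2 * F z) * T z) with (- (2 * F z * T z)) in * by ring.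
    rewrite Cmod_opp in Y.
    pose proof (X _ _ (T z) H2). pose proof (X _ _ (E z) H3).
    pose proof (X _ _ (M z) H4). unfold S. nra.
Qed.

(** The set of points around which E, M and T vanish is open. At a limit q of it,
    vanishing is carried by the linear system along segments inside a disc about q that
    avoid q, the only possible pole in that disc. *)
Lemma EMT_near p : near' p (fun x => reg2 x /\ E x = 0 /\ M x = 0 /\ T x = 0).
Proof.
  revert p. apply (clopen_plane _ 0).
  - exact EMT_near_0.
  - intros p Hp. apply near_imp with (P := fun z => z = p \/ near z
      (fun x => reg2 x /\ E x = 0 /\ M x = 0 /\ T x = 0)).
    + intros z [->|Hz]; [exact Hp | now apply near_near'].
    + apply near'_near; [now left|].
      apply near'_imp with (2 := near'_near_near _ _ Hp). now right.
  - intros q Hq. destruct (reg2_near' q) as [r [r0 Hr]].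
    exists r. split; [exact r0|]. intros b Hb Hbq. split; [now apply Hr|].
    destruct (Hq (r / 2)%R) as [p [Hp Hpq]]; [lra|].
    assert (Hn : near' p (fun z => z <> q)).
    { destruct (classic (p = q)) as [->|N]; [now apply near_all|].
      now apply near_near', near_neq. }
    destruct (near'_exists _ _ (near'_and _ _ _ Hp Hn) (r / 2)%R)
      as [a [_ [Hap [[_ Za] Haq]]]]; [lra|].
    assert (Har : (Cmod (a - q) < r)%R).
    { replace (a - q) with ((a - p) + (p - q)) by ring.
      eapply Rle_lt_trans; [apply Cmod_triangle | lra]. }
    destruct (join_around q r a b Haq Hbq Har Hb) as [m [Hm [Ham Hmb]]].
    apply (EMT_along m b).
    { intros t Ht. apply Hr; [now apply seg_ball | now apply Hmb]. }
    apply (EMT_along a m); [|exact Za].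
    intros t Ht. apply Hr; [now apply seg_ball | now apply Ham].
Qed.

Lemma addition_difference x : Cderivable f x -> Cderivable f (x - s) ->
  F x ^ 2 = f x + f (x - s) + f s /\
  2 * F x * (f x - f (x - s)) = f' x + f' (x - s).
Proof.
  intros D1 D2. assert (R : reg2 x) by now split.
  assert (Z : forall g, ccont g x -> near' x (fun y => g y = 0) -> g x = 0).
  { intros g Hg Hn. apply (clim_unique g x); [exact Hg|].
    apply (clim_ext (fun _ => 0)); [|apply clim_const].
    apply near'_imp with (2 := Hn). auto. }
  split.
  - assert (HE : E x = 0).
    { apply Z; [exact (cderive_cont _ _ _ (E_cderive x R))|].
      apply near'_imp with (2 := EMT_near x). tauto. }
    transitivity (E x + f x + f (x - s) + f s); [unfold E, c; ring|].
    rewrite HE. ring.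
  - assert (HM : M x = 0).
    { apply Z; [exact (cderive_cont _ _ _ (M_cderive x R))|].
      apply near'_imp with (2 := EMT_near x). tauto. }
    transitivity (M x + f' x + f' (x - s)); [unfold M, c, c'; ring|].
    rewrite HM. ring.
Qed.

End Addition.

(** The second equation is the one that expresses the vanishing of M, with x - s in
    place of s: the translate of x by x - s is s. *)
Lemma addition s x :
  Cderivable f s -> Cderivable f x -> Cderivable f (x - s) ->
  (zeta (x - s) + zeta s - zeta x) ^ 2 = f x + f (x - s) + f s /\
  2 * (zeta (x - s) + zeta s - zeta x) * (f x - f s) = f' x + f' s.
Proof.
  intros Ds Dx Dxs. split.
  - destruct (addition_difference s Ds x Dx Dxs) as [K _].
    transitivity ((zeta s + zeta (x - s) - zeta x) ^ 2); [ring | exact K].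
  - assert (Es : x - (x - s) = s) by ring.
    assert (D' : Cderivable f (x - (x - s))) by now rewrite Es.
    destruct (addition_difference (x - s) Dxs x Dx D') as [_ K].
    cbv beta zeta in K. rewrite Es in K. rewrite <- K. ring.
Qed.

(** * Poles of a sum of three translates of zeta *)

Lemma addition_near a p : Cderivable f a ->
  near' p (fun x => Cderivable f x /\ Cderivable f (x - a) /\ f x <> f a /\
    zeta (x - a) + zeta a - zeta x = (f' x + f' a) / (2 * (f x - f a)) /\
    f (x - a) = ((f' x + f' a) / (2 * (f x - f a))) ^ 2 - f x - f a).
Proof.
  intros Da.
  refine (near'_imp _ _ _ _
    (near'_and _ _ _ (reg2_near' a p) (values_isolated (f a) p))).
  intros x [[D1 D2] N].
  destruct (addition a x Da D1 D2) as [HE HM].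
  assert (HF : zeta (x - a) + zeta a - zeta x = (f' x + f' a) / (2 * (f x - f a))).
  { rewrite <- HM. field. now apply Cminus_eq_contra. }
  repeat split; try assumption.
  rewrite <- HF, HE. ring.
Qed.

(** By the addition theorem f (x - a) tends to f a as x tends to p. *)
Lemma translate_finite_at_pole a p :
  Cderivable f a -> to_inf f p -> Cderivable f (p - a).
Proof.
  intros Da Hp. destruct (proj2 (meromorphic_cases _ (p - a) f_mero)) as [D|I]; [exact D|].
  exfalso.
  apply (to_inf_not_clim (fun x => f (x - a)) p (f a)).
  - intros A. exact (proj1 (near'_translate p a _) (I A)).
  - refine (clim_ext _ _ _ _ _ (chord_limit p (fun _ => f a) (fun _ => f' a)
      (f a) (f' a) Hp (clim_const _ _) (clim_const _ _))).
    apply near'_imp with (2 := addition_near a p Da).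
    intros x [_ [_ [_ [_ E]]]]. now rewrite E.
Qed.

(** Otherwise the addition theorem gives f (x - a) a finite limit at p. *)
Lemma translate_pole_value a p :
  Cderivable f a -> Cderivable f p -> to_inf f (p - a) -> f p = f a.
Proof.
  intros Da Dp I. apply NNPP. intros N.
  apply (to_inf_not_clim (fun x => f (x - a)) p
           (((f' p + f' a) / (2 * (f p - f a))) ^ 2 - f p - f a)).
  - intros A. exact (proj1 (near'_translate p a _) (I A)).
  - apply (clim_ext (fun x => ((f' x + f' a) / (2 * (f x - f a))) ^ 2 - f x - f a)).
    { apply near'_imp with (2 := addition_near a p Da).
      intros x [_ [_ [_ [_ E]]]]. now rewrite E. }
    assert (N2 : 2 * (f p - f a) <> 0).
    { apply Cmult_neq_0; [|now apply Cminus_eq_contra].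
      intros X; apply RtoC_inj in X; lra. }
    pose proof (f_cont p Dp) as Hf. pose proof (f'_cont p Dp) as Hf'.
    apply clim_minus; [|apply clim_const]. apply clim_minus; [|exact Hf].
    apply clim_pow, clim_div; [exact N2| |].
    + apply clim_plus; [exact Hf' | apply clim_const].
    + apply clim_mult; [apply clim_const|].
      apply clim_minus; [exact Hf | apply clim_const].
Qed.

Section Combination.

Variables a0 a1 o0 o1 k : C.
Hypothesis a0_reg : Cderivable f a0.
Hypothesis a1_reg : Cderivable f a1.
Hypothesis values_differ : f a0 <> f a1.
Hypothesis o0_nz : o0 <> 0.
Hypothesis o1_nz : o1 <> 0.

Let B (x : C) : C :=
  k + zeta x + o0 * (zeta (x - a0) + zeta a0) + o1 * (zeta (x - a1) + zeta a1).

Let reg3 (x : C) : Prop :=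
  Cderivable f x /\ Cderivable f (x - a0) /\ Cderivable f (x - a1).

Lemma B_cderive x : reg3 x -> cderive B x (- f x - o0 * f (x - a0) - o1 * f (x - a1)).
Proof.
  intros [D [D0 D1]].
  pose proof (zeta_cderive _ (zeta_regular _ D)) as H.
  pose proof (cderive_translate _ _ _ _ (zeta_cderive _ (zeta_regular _ D0))) as H0.
  pose proof (cderive_translate _ _ _ _ (zeta_cderive _ (zeta_regular _ D1))) as H1.
  refine (cderive_eq _ _ _ _ _ (cderive_plus _ _ _ _ _ (cderive_plus _ _ _ _ _
    (cderive_plus _ _ _ _ _ (cderive_const k x) H)
    (cderive_mult _ _ _ _ _ (cderive_const o0 x)
       (cderive_plus _ _ _ _ _ H0 (cderive_const (zeta a0) x))))
    (cderive_mult _ _ _ _ _ (cderive_const o1 x)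
       (cderive_plus _ _ _ _ _ H1 (cderive_const (zeta a1) x))))).
  ring.
Qed.

Lemma zeta_near_regular a x : Cderivable f (x - a) ->
  near x (Cderivable (fun y => zeta (y - a))).
Proof.
  intros D. pose proof (meromorphic_open _ _ z_mero (zeta_regular _ D)) as H.
  apply near_translate in H. apply near_imp with (2 := H).
  intros y. apply Cderivable_translate.
Qed.

Lemma zeta_pole p : ~ Cderivable f p -> exists m, pole zeta p m.
Proof.
  intros N. destruct (z_mero p) as [_ [D|H]]; [|exact H].
  now elim N; apply zeta_singular.
Qed.

(** By the two previous lemmas at most one of the three terms is singular at p: two
    poles among p - a0 and p - a1 would force f a0 = f p = f a1. *)
Lemma B_pole p : ~ reg3 p -> exists m, pole B p m.
Proof.
  intros N.
  assert (cases : forall q, Cderivable f q \/ to_inf f q)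
    by (intros q; now apply meromorphic_cases).
  assert (Dc : forall c q, near q (Cderivable (fun _ => c)))
    by (intros c q; apply near_all; intros; apply Cderivable_const).
  assert (Hz : Cderivable f p -> near p (Cderivable zeta)).
  { intros D. exact (meromorphic_open _ _ z_mero (zeta_regular _ D)). }
  assert (Dp : forall u v q, near q (Cderivable u) -> near q (Cderivable v) ->
            near q (Cderivable (fun y => u y + v y))).
  { intros u v q Hu Hv. apply near_imp with (2 := near_and _ _ _ Hu Hv).
    intros y [A A']. now apply Cderivable_plus. }
  assert (Dm : forall c v q, near q (Cderivable v) ->
            near q (Cderivable (fun y => c * v y))).
  { intros c v q Hv. apply near_imp with (2 := Hv). intros y A.
    apply Cderivable_mult; [apply Cderivable_const | exact A]. }
  destruct (cases p) as [D|I].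
  - destruct (cases (p - a0)) as [D0|I0].
    + destruct (cases (p - a1)) as [D1|I1]; [now elim N; repeat split|].
      destruct (zeta_pole (p - a1) (to_inf_not_derivable _ _ I1)) as [m Hm].
      apply pole_translate in Hm. exists m.
      apply (pole_ext (fun x => o1 * zeta (x - a1)
        + (k + (zeta x + (o0 * (zeta (x - a0) + zeta a0) + o1 * zeta a1))))).
      { intros x. unfold B. ring. }
      apply (pole_plus (fun x => zeta (x - a1))); [exact Hm | exact o1_nz|].
      apply Dp; [apply Dc|]. apply Dp; [now apply Hz|]. apply Dp; [|apply Dc].
      apply (Dm o0 (fun x => zeta (x - a0) + zeta a0)).
      apply Dp; [now apply zeta_near_regular | apply Dc].
    + assert (D1 : Cderivable f (p - a1)).
      { destruct (cases (p - a1)) as [D1|I1]; [exact D1|]. elim values_differ.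
        rewrite <- (translate_pole_value a0 p a0_reg D I0).
        now apply translate_pole_value. }
      destruct (zeta_pole (p - a0) (to_inf_not_derivable _ _ I0)) as [m Hm].
      apply pole_translate in Hm. exists m.
      apply (pole_ext (fun x => o0 * zeta (x - a0)
        + (k + (zeta x + (o1 * (zeta (x - a1) + zeta a1) + o0 * zeta a0))))).
      { intros x. unfold B. ring. }
      apply (pole_plus (fun x => zeta (x - a0))); [exact Hm | exact o0_nz|].
      apply Dp; [apply Dc|]. apply Dp; [now apply Hz|]. apply Dp; [|apply Dc].
      apply (Dm o1 (fun x => zeta (x - a1) + zeta a1)).
      apply Dp; [now apply zeta_near_regular | apply Dc].
  - pose proof (translate_finite_at_pole a0 p a0_reg I) as D0.
    pose proof (translate_finite_at_pole a1 p a1_reg I) as D1.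
    destruct (zeta_pole p (to_inf_not_derivable _ _ I)) as [m Hm]. exists m.
    apply (pole_ext (fun x => 1 * zeta x
      + (k + (o0 * (zeta (x - a0) + zeta a0) + o1 * (zeta (x - a1) + zeta a1))))).
    { intros x. unfold B. ring. }
    apply pole_plus; [exact Hm | intros X; apply RtoC_inj in X; lra|].
    apply Dp; [apply Dc|]. apply Dp.
    + apply (Dm o0 (fun x => zeta (x - a0) + zeta a0)).
      apply Dp; [now apply zeta_near_regular | apply Dc].
    + apply (Dm o1 (fun x => zeta (x - a1) + zeta a1)).
      apply Dp; [now apply zeta_near_regular | apply Dc].
Qed.

Lemma B_regular p : Cderivable B p -> reg3 p.
Proof.
  intros D. apply NNPP. intros N. destruct (B_pole p N) as [m Hm].
  exact (to_inf_not_derivable _ _ (pole_to_inf _ _ _ Hm) D).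
Qed.

Lemma reg3_near' p : near' p reg3.
Proof.
  refine (near'_imp _ _ _ _ (near'_and _ _ _ (reg2_near' a0 p) (reg2_near' a1 p))).
  intros x [[A A0] [_ A1]]. now repeat split.
Qed.

Lemma B_meromorphic : meromorphic B.
Proof.
  intros p. split.
  - apply locally'_near'. apply near'_imp with (2 := reg3_near' p).
    intros x R. exact (cderive_derivable _ _ _ (B_cderive x R)).
  - destruct (classic (reg3 p)) as [R|N].
    + left. exact (cderive_derivable _ _ _ (B_cderive p R)).
    + right. now apply B_pole.
Qed.

(** Away from the isolated points where f takes the value f a0 or f a1, both B and its
    derivative are rational in f and its derivative; whatever polynomial relation
    follows between them extends by continuity to all regular points of B. *)
Lemma B_chords p : o0 + o1 = - (1) -> near' p (fun x =>
  let F0 := (f' x + f' a0) / (2 * (f x - f a0)) in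
  let F1 := (f' x + f' a1) / (2 * (f x - f a1)) in
  f x <> f a0 /\ f x <> f a1 /\ Cderivable f x /\
  B x = k + o0 * F0 + o1 * F1 /\
  - f x - o0 * f (x - a0) - o1 * f (x - a1)
    = - f x - o0 * (F0 ^ 2 - f x - f a0) - o1 * (F1 ^ 2 - f x - f a1)).
Proof.
  intros Ho.
  refine (near'_imp _ _ _ _ (near'_and _ _ _ (addition_near a0 p a0_reg)
                               (addition_near a1 p a1_reg))).
  intros x [[Dx [_ [N0 [E0 C0]]]] [_ [_ [N1 [E1 C1]]]]] F0 F1.
  repeat split; try assumption.
  - unfold F0, F1. rewrite <- E0, <- E1.
    transitivity (B x - zeta x * (o0 + o1 + 1)); [rewrite Ho | unfold B]; ring.
  - unfold F0, F1. now rewrite <- C0, <- C1.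
Qed.

(** Around each point the relation is only known outside isolated points; it extends
    because the derivative of B at a regular point is an expression continuous there. *)
Lemma B_relation (R : C -> C -> C) :
  (forall u v p b b', clim u p b -> clim v p b' ->
     clim (fun x => R (u x) (v x)) p (R b b')) ->
  (forall p, near' p (fun x =>
     R (B x) (- f x - o0 * f (x - a0) - o1 * f (x - a1)) = 0)) ->
  mero_solution R B.
Proof.
  intros HR H. split; [exact B_meromorphic|].
  intros z Dz. pose proof (B_regular z Dz) as Rz.
  rewrite (cderive_C_derive _ _ _ (B_cderive z Rz)).
  destruct Rz as [D [D0 D1]].
  apply (clim_unique (fun x => R (B x) (- f x - o0 * f (x - a0) - o1 * f (x - a1))) z).
  - apply HR.
    + exact (cderive_cont _ _ _ (derivable_cderive _ _ Dz)).
    + pose proof (f_cont _ D) as H2.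
      pose proof (clim_translate _ _ _ _ (f_cont _ D0)) as H3.
      pose proof (clim_translate _ _ _ _ (f_cont _ D1)) as H4.
      repeat first [ exact H2 | exact H3 | exact H4 | apply clim_const
                   | apply clim_minus | apply clim_mult | apply clim_opp ].
  - apply (clim_ext (fun _ => 0)); [|apply clim_const].
    apply near'_imp with (2 := H z). auto.
Qed.

End Combination.

End Elliptic.

(** * The first order equation as an identity on the cubic curve *)

(** Here g stands for wp + 2 e1, y for wp', h for kappa / 4 and w for 3 e1 + 4 i e0. With
    e1 = h^2 / 3 the cubic becomes the hypothesis on y * y, and D is the product of the
    differences of wp with its values at the two points xi. Modulo that hypothesis every
    quantity has the form p + q y with p and q free of y, and the claim splits into two
    rational identities in g, h and w. *)
Lemma amplitude_curve (h w g y D : C) :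
  D = g * g + 3 * w * w -> D <> 0 ->
  y * y = 4 * g * D - 8 * h * h * g * (g + 3 * w) ->
  let b := 2 * h - (24 * h * w * w + (g + 3 * w) * y) / (2 * D) in
  let S := y * y * (3 * w * w - 6 * w * g - g * g) - 96 * h * w * w * g * y
           + 48 * h * h * w * w * (g * g - 6 * w * g - 3 * w * w) in
  let b' := - 2 * g + 2 * h * h - 3 * w - S / (4 * D * D) in
  let u := 6 * w - 6 * h * h in
  (2 * b' + 4 * h * b + u) * (b' - 4 * h * b - u) ^ 2
  + / 2 ^ 11 * (16 * (4 * b ^ 3 - 12 * h * b ^ 2) - 9 * 16 * w * (4 * b + 4 * h)) ^ 2 = 0.
Proof.
  intros HD D0 Hy b S b' u.
  set (Y := 4 * g * D - 8 * h * h * g * (g + 3 * w)) in Hy.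
  set (p := 2 * h - 12 * h * w * w / D). set (q := - (g + 3 * w) / (2 * D)).
  set (p' := - 2 * g + 2 * h * h - 3 * w - (Y * (3 * w * w - 6 * w * g - g * g)
               + 48 * h * h * w * w * (g * g - 6 * w * g - 3 * w * w)) / (4 * D * D)).
  set (q' := 24 * h * w * w * g / (D * D)).
  assert (Eb : b = p + q * y) by (unfold b, p, q; field; exact D0).
  assert (Eb' : b' = p' + q' * y).
  { unfold b', S. rewrite Hy. unfold p', q'. field; exact D0. }
  set (v0 := 2 * p' + 4 * h * p + u). set (v1 := 2 * q' + 4 * h * q).
  set (u0 := p' - 4 * h * p - u). set (u1 := q' - 4 * h * q).
  set (w0 := 64 * (p * p * p + 3 * p * q * q * Y) - 192 * h * (p * p + q * q * Y)
             - 576 * w * (p + h)).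
  set (w1 := 64 * (3 * p * p * q + q * q * q * Y) - 384 * h * p * q - 576 * w * q).
  assert (EW : 16 * (4 * b ^ 3 - 12 * h * b ^ 2) - 9 * 16 * w * (4 * b + 4 * h) = w0 + w1 * y).
  { rewrite Eb. unfold w0, w1. rewrite <- Hy. ring. }
  rewrite EW, Eb', Eb.
  transitivity ((v0 * (u0 * u0 + u1 * u1 * Y) + 2 * v1 * u0 * u1 * Y
                  + / 2 ^ 11 * (w0 * w0 + w1 * w1 * Y))
     + (2 * v0 * u0 * u1 + v1 * (u0 * u0 + u1 * u1 * Y) + / 2 ^ 11 * (2 * w0 * w1)) * y).
  { rewrite <- Hy. unfold v0, v1, u0, u1. field. }
  assert (A0 : v0 * (u0 * u0 + u1 * u1 * Y) + 2 * v1 * u0 * u1 * Y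
                  + / 2 ^ 11 * (w0 * w0 + w1 * w1 * Y) = 0).
  { unfold v0, v1, u0, u1, w0, w1, p', q', p, q, u, Y. clear - HD D0. subst D.
    field. exact D0. }
  assert (A1 : 2 * v0 * u0 * u1 + v1 * (u0 * u0 + u1 * u1 * Y)
               + / 2 ^ 11 * (2 * w0 * w1) = 0).
  { unfold v0, v1, u0, u1, w0, w1, p', q', p, q, u, Y. clear - HD D0. subst D.
    field. exact D0. }
  rewrite A0, A1. ring.
Qed.

(** Here j stands for i sqrt 3. The two chords have denominators whose product is D,
    and all terms odd in j cancel by symmetry. *)
Section ThreeChords.

Variables (h w g y j : C).
Hypothesis j2 : j * j = - (3).
Hypothesis N0 : g - j * w <> 0.
Hypothesis N1 : g + j * w <> 0.

Let D := g * g + 3 * w * w.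
Let o0 := (- 1 + j) / 2.
Let o1 := (- 1 - j) / 2.
Let n0 := 2 * (3 - j) * h * w.
Let n1 := 2 * (3 + j) * h * w.
Let F0 := (y + n0) / (2 * (g - j * w)).
Let F1 := (y + n1) / (2 * (g + j * w)).

Lemma D_factor : D = (g - j * w) * (g + j * w).
Proof. transitivity (g * g - j * j * (w * w)); [rewrite j2; unfold D|]; ring. Qed.

Lemma D_nz : D <> 0.
Proof. rewrite D_factor. now apply Cmult_neq_0. Qed.

Lemma F0_D : F0 = (y + n0) * (g + j * w) / (2 * D).
Proof. rewrite D_factor. unfold F0. field. now split. Qed.

Lemma F1_D : F1 = (y + n1) * (g - j * w) / (2 * D).
Proof. rewrite D_factor. unfold F1. field. now split. Qed.

Lemma chords_sum :
  2 * h + o0 * F0 + o1 * F1 = 2 * h - (24 * h * w * w + (g + 3 * w) * y) / (2 * D).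
Proof.
  pose proof D_nz as HD. rewrite F0_D, F1_D. unfold o0, o1, n0, n1.
  generalize D HD. clear N0 N1 HD. intros d Hd.
  field_simplify_eq; [|exact Hd]. ring_simplify [j2]. ring.
Qed.

Lemma chords_squares_sum :
  let e1 := h * h / 3 in let f := g - 2 * e1 in
  - f - o0 * (F0 ^ 2 - f - (- 2 * e1 + j * w)) - o1 * (F1 ^ 2 - f - (- 2 * e1 - j * w))
  = - 2 * g + 2 * h * h - 3 * w
    - (y * y * (3 * w * w - 6 * w * g - g * g) - 96 * h * w * w * g * y
       + 48 * h * h * w * w * (g * g - 6 * w * g - 3 * w * w)) / (4 * D * D).
Proof.
  intros e1 f. pose proof D_nz as HD. rewrite F0_D, F1_D. unfold f, e1, o0, o1, n0, n1.
  generalize D HD. clear N0 N1 HD f e1. intros d Hd.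
  field_simplify_eq; [|exact Hd]. ring_simplify [j2]. ring.
Qed.

End ThreeChords.

Theorem mainTheorem3
  (kappa e0 e1 : R) (wp zeta : C -> C) (xi : nat -> C)
  (h_nonzero : (kappa, e0) <> (0%R, 0%R))
  (h_e1 : e1 = (kappa ^ 2 / 48)%R)
  (h_weierstrass :
     weierstrass (12 * (13 * e1 ^ 2 + 16 * e0 ^ 2))
                 (8 * (35 * e1 ^ 2 + 48 * e0 ^ 2) * e1) wp zeta)
  (h_xi : forall k : nat, k = 0%nat \/ k = 1%nat ->
     Cderivable wp (xi k) /\
     wp (xi k) = - 2 * e1 + (- 1) ^ k * Ci * sqrt 3 * (3 * e1 + 4 * Ci * e0) /\
     C_derive wp (xi k) =
       1 / 2 * (3 - (- 1) ^ k * Ci * sqrt 3) * kappa * (3 * e1 + 4 * Ci * e0)) :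
  let B : C -> C := fun x =>
    kappa / 2 + zeta x
    + (- 1 + Ci * sqrt 3) / 2 * (zeta (x - xi 0%nat) + zeta (xi 0%nat))
    + (- 1 - Ci * sqrt 3) / 2 * (zeta (x - xi 1%nat) + zeta (xi 1%nat)) in
  let ode : C -> C -> C := fun b b' =>
    (2 * b' + kappa * b + 24 * Ci * e0) * (b' - kappa * b - 24 * Ci * e0) ^ 2
    + / 2 ^ 11 * (16 * (4 * b ^ 3 - 3 * kappa * b ^ 2)
                  - 9 * (kappa ^ 2 + 64 * Ci * e0) * (4 * b + kappa)) ^ 2 in
  mero_eq B (fun x =>
    kappa / 2
    - (6 * kappa * (3 * e1 + 4 * Ci * e0) ^ 2
       + (wp x + 2 * e1 + 3 * (3 * e1 + 4 * Ci * e0)) * C_derive wp x)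
      / (2 * ((wp x + 2 * e1) ^ 2 + 3 * (3 * e1 + 4 * Ci * e0) ^ 2))) /\
  mero_solution ode B /\
  (forall a : C, mero_solution ode (fun x => B (x - a))).
Proof.
  intros B ode.
  destruct h_weierstrass as [f_mero [pole0 [f_ode [z_mero [z_odd z_der]]]]].
  pose proof (pole_to_inf _ _ _ pole0) as f_pole.
  set (G2 := 12 * (13 * e1 ^ 2 + 16 * e0 ^ 2)) in *.
  set (G3 := 8 * (35 * e1 ^ 2 + 48 * e0 ^ 2) * e1) in *.
  change (forall z, Cderivable wp z -> C_derive wp z ^ 2 = cubic G2 G3 (wp z)) in f_ode.
  set (j := Ci * sqrt 3) in *.
  set (w := 3 * e1 + 4 * Ci * e0) in *.
  set (h := kappa / 4).
  assert (Ci2 : Ci * Ci = - (1)) by (apply injective_projections; simpl; ring).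
  assert (j2 : j * j = - (3)).
  { transitivity (Ci * Ci * RtoC (sqrt 3 * sqrt 3)); [unfold j; rewrite RtoC_mult; ring|].
    rewrite sqrt_sqrt by lra. rewrite Ci2. ring. }
  assert (Ek : RtoC kappa = 4 * h) by (unfold h; field).
  assert (Ee1 : RtoC e1 = h * h / 3).
  { rewrite h_e1. unfold h.
    rewrite RtoC_div, RtoC_pow by lra. field. }
  assert (Ee0 : Ci * e0 = (w - h * h) / 4).
  { unfold w. rewrite Ee1. field. }
  assert (w_nz : w <> 0).
  { intros E. apply h_nonzero. unfold w in E.
    assert (E1 := f_equal fst E). assert (E2 := f_equal snd E). simpl in E1, E2.
    assert (e1 = 0%R) by lra. assert (e0 = 0%R) by lra.
    assert (Hk : (kappa ^ 2 = 0)%R) by lra.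
    assert (kappa = 0%R) by nra. now subst. }
  assert (H0 := h_xi 0%nat (or_introl eq_refl)).
  assert (H1 := h_xi 1%nat (or_intror eq_refl)).
  destruct H0 as [a0_reg [V0 W0]]. destruct H1 as [a1_reg [V1 W1]].
  set (a0 := xi 0%nat) in *. set (a1 := xi 1%nat) in *.
  assert (V0' : wp a0 = - 2 * (h * h / 3) + j * w).
  { rewrite V0, Ee1. unfold j. simpl. ring. }
  assert (V1' : wp a1 = - 2 * (h * h / 3) - j * w).
  { rewrite V1, Ee1. unfold j. simpl. ring. }
  assert (W0' : C_derive wp a0 = 2 * (3 - j) * h * w).
  { rewrite W0, Ek. unfold j. simpl. field. }
  assert (W1' : C_derive wp a1 = 2 * (3 + j) * h * w).
  { rewrite W1, Ek. unfold j. simpl. field. }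
  assert (j_nz : j <> 0).
  { intros E. rewrite E in j2. apply (f_equal fst) in j2. simpl in j2. lra. }
  assert (values_differ : wp a0 <> wp a1).
  { rewrite V0', V1'. intros E.
    apply (Cmult_neq_0 (2 * j) w); [|exact w_nz|].
    - apply Cmult_neq_0; [|exact j_nz]. intros X. apply RtoC_inj in X. lra.
    - transitivity (- 2 * (h * h / 3) + j * w - (- 2 * (h * h / 3) - j * w)); [ring|].
      rewrite E. ring. }
  set (o0 := (- 1 + j) / 2) in *. set (o1 := (- 1 - j) / 2) in *.
  assert (j_ne : forall e : C, e * e = 1 -> j <> e).
  { intros e He E. rewrite E, He in j2. apply (f_equal fst) in j2. simpl in j2. lra. }
  assert (o0_nz : o0 <> 0).
  { intros E. apply (j_ne 1); [ring|].
    transitivity (2 * o0 + 1); [unfold o0; field | rewrite E; ring]. }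
  assert (o1_nz : o1 <> 0).
  { intros E. apply (j_ne (- (1))); [ring|].
    transitivity (- (2 * o1) - 1); [unfold o1; field | rewrite E; ring]. }
  assert (o_sum : o0 + o1 = - (1)) by (unfold o0, o1; field).
  assert (e0_sqr : RtoC e0 * e0 = - ((w - h * h) / 4 * ((w - h * h) / 4))).
  { rewrite <- Ee0. transitivity (- (Ci * Ci) * (e0 * e0)); [rewrite Ci2|]; ring. }
  assert (curve : forall x, Cderivable wp x -> let g := wp x + 2 * (h * h / 3) in
    C_derive wp x * C_derive wp x =
      4 * g * (g * g + 3 * w * w) - 8 * h * h * g * (g + 3 * w)).
  { intros x Dx g. transitivity (C_derive wp x ^ 2); [ring|].
    rewrite (f_ode x Dx). unfold cubic, G2, G3, g.
    transitivity (4 * wp x ^ 3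
      - 12 * (13 * (e1 * e1) + 16 * (e0 * e0)) * wp x
      - 8 * (35 * (e1 * e1) + 48 * (e0 * e0)) * e1); [ring|].
    rewrite e0_sqr, Ee1. field. }
  assert (near_values : forall p, near' p (fun x =>
    let g := wp x + 2 * (h * h / 3) in let y := C_derive wp x in
    let D := g * g + 3 * w * w in
    let b := 2 * h - (24 * h * w * w + (g + 3 * w) * y) / (2 * D) in
    let b' := - 2 * g + 2 * h * h - 3 * w
      - (y * y * (3 * w * w - 6 * w * g - g * g) - 96 * h * w * w * g * y
         + 48 * h * h * w * w * (g * g - 6 * w * g - 3 * w * w)) / (4 * D * D) in
    Cderivable wp x /\ D <> 0 /\ B x = b /\
    - wp x - o0 * wp (x - a0) - o1 * wp (x - a1) = b')).
  { intros p.
    refine (near'_imp _ _ _ _ (B_chords wp G2 G3 f_mero f_pole f_ode zeta z_mero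
      z_odd z_der a0 a1 o0 o1 (kappa / 2) a0_reg a1_reg p o_sum)).
    cbv zeta. intros x [N0 [N1 [Dx [EB EB']]]].
    set (g := wp x + 2 * (h * h / 3)). set (y := C_derive wp x) in *.
    rewrite V0', V1', W0', W1' in *.
    assert (g0 : wp x - (- 2 * (h * h / 3) + j * w) = g - j * w) by (unfold g; ring).
    assert (g1 : wp x - (- 2 * (h * h / 3) - j * w) = g + j * w) by (unfold g; ring).
    assert (M0 : g - j * w <> 0) by (rewrite <- g0; now apply Cminus_eq_contra).
    assert (M1 : g + j * w <> 0) by (rewrite <- g1; now apply Cminus_eq_contra).
    rewrite g0, g1 in EB, EB'.
    split; [exact Dx|]. split; [exact (D_nz w g j j2 M0 M1)|]. split.
    - change (B x) with (kappa / 2 + zeta x + o0 * (zeta (x - a0) + zeta a0)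
                         + o1 * (zeta (x - a1) + zeta a1)).
      rewrite EB, <- (chords_sum h w g y j j2 M0 M1).
      replace (kappa / 2) with (2 * h) by (unfold h; field). reflexivity.
    - rewrite EB', <- (chords_squares_sum h w g y j j2 M0 M1). cbv zeta.
      replace (g - 2 * (h * h / 3)) with (wp x) by (unfold g; ring). reflexivity. }
  assert (HB : mero_solution ode B).
  { apply (B_relation wp G2 G3 f_mero f_pole f_ode zeta z_mero z_odd z_der
      a0 a1 o0 o1 (kappa / 2) a0_reg a1_reg values_differ o0_nz o1_nz ode).
    - intros u v p b b' Hu Hv. unfold ode.
      repeat first [ apply clim_const | exact Hu | exact Hv | apply clim_pow
                   | apply clim_minus | apply clim_plus | apply clim_mult ].
    - intros p. apply near'_imp with (2 := near_values p). cbv zeta.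
      intros x [Dx [D0 [EB EB']]].
      change (ode (B x) (- wp x - o0 * wp (x - a0) - o1 * wp (x - a1)) = 0).
      pose proof (amplitude_curve h w _ _ _ eq_refl D0 (curve x Dx)) as K.
      cbv zeta in K. rewrite <- EB, <- EB' in K. unfold ode.
      generalize dependent (- wp x - o0 * wp (x - a0) - o1 * wp (x - a1)).
      intros b' _ K.
      replace (24 * Ci * e0) with (6 * w - 6 * h * h)
        by (transitivity (24 * (Ci * e0)); [rewrite Ee0; field | ring]).
      replace (kappa ^ 2 + 64 * Ci * e0) with (16 * w)
        by (transitivity (kappa ^ 2 + 64 * (Ci * e0)); [rewrite Ee0, Ek; field | ring]).
      rewrite Ek. etransitivity; [|exact K]. field. }
  split; [|split].
  - apply mero_eq_near. intros p. apply near'_imp with (2 := near_values p). cbv zeta.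
    intros x [_ [D0 [EB _]]]. rewrite EB, Ek, Ee1.
    set (g := wp x + 2 * (h * h / 3)) in *.
    replace (g ^ 2 + 3 * w ^ 2) with (g * g + 3 * w * w) by ring.
    field. exact D0.
  - exact HB.
  - intros a. now apply mero_solution_translate.
Qed.
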